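(* Let $G$ be a connected unicyclic graph on $n$ vertices such that $G\not\cong C_n$, $G\not\cong D_n$, and $G\not\cong U_n$. Then $C_n\prec G\prec U_n$.
   Context: All graphs are finite, simple and undirected. A connected unicyclic graph is a connected graph containing exactly one cycle. The independence polynomial of a graph $G$ is $I(G,x)=\sum_{k\ge 0} i_kx^k$, where $i_k$ is the number of independent sets of size $k$ in $G$. It is known that the root of $I(G,x)$ of smallest modulus is real and lies in $[-1,0)$; it is denoted $\xi(G)$ (equivalently, $\xi(G)$ is the largest real root of $I(G,x)$). For graphs $G,H$, write $H\preceq G$ if and only if $I(H,x)\ge I(G,x)$ for all $x\in[\xi(G),0]$, and $H\prec G$ if and only if $H\preceq G$ and $I(H,x)\neq I(G,x)$ as polynomials. $C_n$ ($n\ge 3$) is the cycle on $n$ vertices. $D_n$ ($n\ge 3$) is the graph with vertices $u_1,\dots,u_n$ consisting of the triangle $u_1u_2u_3$ together with the path $u_3u_4\cdots u_n$. $U_n$ ($n\ge 3$) is the graph on $n$ vertices obtained from a triangle by attaching $n-3$ pendant vertices (leaves) to one fixed vertex of the triangle. *)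

(* Defs.v *)
From HB Require Import structures.
From mathcomp Require Import all_boot all_order all_algebra.
From mathcomp Require Import complex.
From mathcomp Require Import boolp classical_sets reals.

Set Implicit Arguments.
Unset Strict Implicit.
Unset Printing Implicit Defensive.

Import Order.TTheory GRing.Theory Num.Theory.

Record sgraph := SGraph {
  vertex :> finType;
  adj : rel vertex;
  adj_sym : symmetric adj;
  adj_irrefl : irreflexive adj }.

Section GraphOfRel.
Variables (T : finType) (r : rel T).

Definition sym_adj : rel T := [rel x y | (x != y) && (r x y || r y x)].

Lemma sym_adj_sym : symmetric sym_adj.
Proof. by move=> x y; rewrite /sym_adj /= eq_sym orbC. Qed.

Lemma sym_adj_irrefl : irreflexive sym_adj.
Proof. by move=> x; rewrite /sym_adj /= eqxx. Qed.

Definition graph_of_rel : sgraph := SGraph sym_adj_sym sym_adj_irrefl.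
End GraphOfRel.

Definition isomorphic (G H : sgraph) : Prop :=
  exists f : G -> H, bijective f /\ forall x y, adj (f x) (f y) = adj x y.

(* Vertices are numbered from 0, and the three families are only meaningful for
   n >= 3; [ordS i] is [i + 1] modulo [n]. *)
Definition cycle_graph (n : nat) : sgraph :=
  graph_of_rel [rel i j : 'I_n | j == ordS i].

(* Triangle 0, 1, 2 followed by the path 2, 3, ..., n - 1. *)
Definition D_graph (n : nat) : sgraph :=
  graph_of_rel
    [rel i j : 'I_n | (j == i.+1 :> nat) || (i == 0 :> nat) && (j == 2 :> nat)].

(* Triangle 0, 1, 2 with the leaves 3, ..., n - 1 attached to 0. *)
Definition U_graph (n : nat) : sgraph :=
  graph_of_rel
    [rel i j : 'I_n | (i == 0 :> nat) || (i == 1 :> nat) && (j == 2 :> nat)].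

Definition connected_graph (G : sgraph) : Prop :=
  forall x y : G, connect (@adj G) x y.

(* A cycle is a subgraph, hence identified by its set of edges: vertex sequences
   that differ by rotation or reversal describe the same cycle. *)
Definition cycle_edges (G : sgraph) (c : seq G) : {set {set G}} :=
  [set [set x; next c x] | x in c]%SET.

Definition is_cycle (G : sgraph) (F : {set {set G}}) : Prop :=
  exists c : seq G,
    [/\ (2 < size c)%N, ucycle (@adj G) c & F = cycle_edges c].

Definition connected_unicyclic (G : sgraph) : Prop :=
  connected_graph G /\ exists! F : {set {set G}}, is_cycle F.

Definition independent (G : sgraph) (A : {set G}) : bool :=
  [forall x in A, forall y in A, ~~ adj x y].

Local Open Scope ring_scope.

Section IndependencePolynomial.
Variable R : realType.

Definition indep_num (G : sgraph) (k : nat) : nat :=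
  #|[set A : {set G} | independent A & #|A| == k]%SET|.

Definition indep_poly (G : sgraph) : {poly R} :=
  \poly_(k < #|G|.+1) (indep_num G k)%:R.

(* [x] is a real number that is a root of smallest modulus among all complex
   roots of I(G, .). It is unique, since two such numbers would be opposite and
   I(G, .), having nonnegative coefficients and I(G, 0) = 1, is positive on
   nonnegative numbers. *)
Definition is_xi (G : sgraph) (x : R) : Prop :=
  root (map_poly (real_complex R) (indep_poly G)) x%:C%C /\
  forall z : R[i],
    root (map_poly (real_complex R) (indep_poly G)) z -> `|x%:C%C| <= `|z|.

(* The default value 0 is only reached by the graph without vertices. *)
Definition xi (G : sgraph) : R := xget 0 [set x | is_xi G x]%classic.

Definition preceq (H G : sgraph) : Prop :=
  forall x : R, xi G <= x <= 0 -> (indep_poly G).[x] <= (indep_poly H).[x].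

Definition prec (H G : sgraph) : Prop :=
  preceq H G /\ indep_poly H <> indep_poly G.
End IndependencePolynomial.

(* Main.v *)
(* A point of [xi(G), 0] has no root of I(G) to its right, and this positivity passes to
   induced subgraphs, so that I is antitone under inclusion there.

   Upper bound: a unicyclic graph is a cycle to which leaves are added one by one. Adding a
   leaf at [u] adds x * I(S - u), and I(S - u) is at most the polynomial of one edge and
   isolated vertices, with equality for the centre of U_n. The cycle itself is handled by
   the recursion c_(n+2) = c_(n+1) + x c_n of c_n = I(C_n).

   Lower bound: while there is a leaf, follow the path leading from it to the first
   vertex [w] of degree at least 3, and replace an edge [wz] outside this path by the edge
   from the leaf to [z]. This keeps the graph connected with n edges, removes one leaf and
   does not decrease I on the interval; without leaves the graph is C_n.

   The polynomials are told apart by the coefficient of x^3: a leaf added at [u] contributes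
   deg(u) plus a quantity depending only on the number of vertices. *)
Require Import Defs.
From mathcomp Require Import all_boot all_order all_algebra.
From mathcomp Require Import complex polyrcf.
From mathcomp Require Import reals.
From mathcomp Require classical_sets.
From mathcomp Require Import zify ring lra.

Set Implicit Arguments.
Unset Strict Implicit.
Unset Printing Implicit Defensive.

Import Order.TTheory GRing.Theory Num.Theory.
Local Open Scope ring_scope.

(** The order depends on [xi], which is nowhere computed. Estimates are stated instead for an
    arbitrary [x] such that some polynomial is positive on the half-open interval from [x] to 0.
    This property passes down to induced subgraphs and up to larger polynomials, so it survives
    every induction; the left endpoint is recovered by continuity. In the lower bound the positive
    polynomial is that of G, in the upper bound that of U_n. Deleting vertices changes the vertex
    set and moving an edge changes the adjacency, hence polynomials indexed by a relation [e] and a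
    set [S] over one vertex type. Unicyclic graphs have two descriptions: [unicyc], a construction
    by leaves, and connectedness with degree sum [2n], which an edge move preserves by mere
    counting. The coefficients of 1, x and x^2 agree for all unicyclic graphs on n vertices, so x^3
    is the first that can differ. D_n has to be excluded because I(D_n) = I(C_n): the recursions at
    a triangle vertex of degree 2 and at a vertex of the cycle have the same terms. *)

(** * Independence polynomials of induced subgraphs: vertex and edge recursions *)

Section IndependencePolynomialOfRel.
Variables (R : rcfType) (T : finType).
Implicit Types (e : rel T) (S A : {set T}).

Definition indep e A := [forall x in A, forall y in A, ~~ e x y].

Lemma indepP e A :
  reflect {in A &, forall x y, ~~ e x y} (indep e A).
Proof.
apply: (iffP forall_inP) => [h x y xA yA|h x xA].
  exact: (forall_inP (h x xA)).
by apply/forall_inP => y yA; apply: h.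
Qed.

Definition ipoly e S : {poly R} :=
  \sum_(A : {set T} | (A \subset S) && indep e A) 'X^#|A|.

Definition cnbhd e v : {set T} := v |: [set y | e v y].

Lemma eq_ipoly e e' S :
  {in S &, e =2 e'} -> ipoly e S = ipoly e' S.
Proof.
move=> h; apply: eq_bigl => A; case: (boolP (A \subset S)) => //= /subsetP sAS.
by apply/indepP/indepP => hA x y xA yA; have := hA x y xA yA; rewrite h ?sAS.
Qed.

Lemma ipoly0 e : ipoly e set0 = 1.
Proof.
rewrite /ipoly (big_pred1 set0) ?cards0 // => A /=.
rewrite subset0; case: eqP => //= ->.
by apply/indepP => x y; rewrite inE.
Qed.

Lemma ipolyD1 e S v : symmetric e -> irreflexive e -> v \in S ->
  ipoly e S = ipoly e (S :\ v) + 'X * ipoly e (S :\: cnbhd e v).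
Proof.
move=> es ei vS; rewrite {1}/ipoly (bigID (fun A : {set T} => v \notin A)) /=.
congr (_ + _).
  by apply: eq_bigl => A; rewrite subsetD1 andbAC.
rewrite mulr_sumr (reindex_onto (fun A => v |: A) (fun A => A :\ v)) /=; last first.
  by move=> A /andP[_ /negbNE vA]; rewrite setD1K.
apply: eq_big => [A|A].
  rewrite setU11 andbT; apply/idP/idP.
    case/andP=> /andP[sA /indepP iA] /eqP dA.
    have vA : v \notin A by rewrite -dA !inE eqxx.
    apply/andP; split; last first.
      by apply/indepP => x y xA yA; apply: iA; rewrite inE ?xA ?yA orbT.
    apply/subsetP => x xA; rewrite !inE negb_or; apply/andP; split; last first.
      by apply: (subsetP sA); rewrite !inE xA orbT.
    apply/andP; split; first by apply: contraNneq vA => <-.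
    by apply: iA; rewrite !inE ?eqxx ?xA ?orbT.
  case/andP=> sA /indepP iA.
  have nb x : x \in A -> [/\ x != v, ~~ e v x & x \in S].
    by move=> /(subsetP sA); rewrite !inE negb_or => /andP[/andP[]].
  have vA : v \notin A by apply/negP => /nb[]; rewrite eqxx.
  apply/andP; split; last first.
    apply/eqP/setP => x; rewrite !inE; case: eqP => // ->.
    by rewrite (negPf vA).
  apply/andP; split.
    by apply/subsetP => x; rewrite !inE => /orP[/eqP->//|/nb[]].
  apply/indepP => x y; rewrite !inE => /orP[/eqP->|xA] /orP[/eqP->|yA].
  - by rewrite ei.
  - by case: (nb y).
  - by rewrite es; case: (nb x).
  - exact: iA.
case/andP=> _ /eqP dA.
by rewrite cardsU1 -{1}dA !inE eqxx /= exprS.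
Qed.

(* Adding the edge [uv] loses exactly the independent sets containing both ends. *)
Lemma ipoly_add_edge e e' S u v : symmetric e -> irreflexive e ->
  u != v -> ~~ e u v -> u \in S -> v \in S ->
  (forall x y, e' x y = e x y || ((x == u) && (y == v) || (x == v) && (y == u))) ->
  ipoly e' S = ipoly e S - 'X^2 * ipoly e (S :\: cnbhd e u :\: cnbhd e v).
Proof.
move=> es ei uv euv uS vS he.
apply/eqP; rewrite eq_sym subr_eq; apply/eqP.
rewrite {1}/ipoly (bigID (fun A : {set T} => ~~ ((u \in A) && (v \in A)))) /=.
congr (_ + _).
  apply: eq_bigl => A; rewrite -andbA; congr (_ && _).
  apply/andP/indepP => [[/indepP iA nA] x y xA yA|iA].
    rewrite he negb_or iA //=; apply: contra nA.
    by case/orP=> /andP[/eqP<- /eqP<-]; rewrite xA yA.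
  split; first by apply/indepP => x y xA yA; have := iA x y xA yA; rewrite he negb_or => /andP[].
  by apply/negP => /andP[uA vA]; have := iA u v uA vA; rewrite he !eqxx orbT.
rewrite mulr_sumr (reindex_onto (fun A => u |: (v |: A)) (fun A => A :\ u :\ v)) /=; last first.
  move=> A /andP[_ /negbNE /andP[uA vA]].
  by rewrite setD1K ?setD1K // !inE eq_sym uv.
apply: eq_big => [A|A].
  rewrite !inE !eqxx orbT /= andbT; apply/idP/idP.
    case/andP=> /andP[sA /indepP iA] /eqP dA.
    have vA : v \notin A by rewrite -dA !inE eqxx.
    have uA : u \notin A by rewrite -dA !inE eqxx andbF.
    apply/andP; split; last first.
      by apply/indepP => x y xA yA; apply: iA; rewrite !inE ?xA ?yA !orbT.
    apply/subsetP => x xA; rewrite !inE !negb_or.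
    have -> : x \in S by apply: (subsetP sA); rewrite !inE xA !orbT.
    have -> : x != u by apply: contraNneq uA => <-.
    have -> : x != v by apply: contraNneq vA => <-.
    by rewrite /= andbT; apply/andP; split; apply: iA; rewrite !inE ?eqxx ?xA ?orbT.
  case/andP=> sA /indepP iA.
  have nb x : x \in A -> [/\ x != u, x != v, ~~ e u x, ~~ e v x & x \in S].
    by move=> /(subsetP sA); rewrite !inE !negb_or => /andP[/andP[-> ->] /andP[/andP[-> ->]]].
  have vA : v \notin A by apply/negP => /nb[]; rewrite eqxx.
  have uA : u \notin A by apply/negP => /nb[]; rewrite eqxx.
  apply/andP; split; last first.
    apply/eqP/setP => x; rewrite !inE; case: (x =P v) => [->|_] /=; first by rewrite (negPf vA).
    by case: (x =P u) => [->|_] //=; rewrite (negPf uA).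
  apply/andP; split.
    by apply/subsetP => x; rewrite !inE => /or3P[/eqP->//|/eqP->//|/nb[]].
  apply/indepP => x y; rewrite !inE.
  case/or3P=> [/eqP->|/eqP->|xA] /or3P[/eqP->|/eqP->|yA]; rewrite ?ei //.
  - by case: (nb y).
  - by rewrite es.
  - by case: (nb y).
  - by rewrite es; case: (nb x).
  - by rewrite es; case: (nb x).
  - exact: iA.
case/andP=> _ /eqP dA.
have vA : v \notin A by rewrite -dA !inE eqxx.
have uA : u \notin A by rewrite -dA !inE eqxx andbF.
by rewrite cardsU1 cardsU1 !inE (negPf uv) (negPf uA) (negPf vA) -exprD.
Qed.

End IndependencePolynomialOfRel.

(** * Polynomials positive on a half-open interval ending at 0 *)

Section PositivityOnIntervals.
Variable R : rcfType.
Implicit Types (p q : {poly R}) (x y : R).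

(** Open at [x] so that [x] may be [xi], a root of the polynomial. *)
Definition pos_on x p := forall y, x < y <= 0 -> 0 < p.[y].

Lemma horner_le_closed x p q : x < 0 ->
  (forall y, x < y <= 0 -> p.[y] <= q.[y]) -> p.[x] <= q.[x].
Proof.
move=> x0 h; rewrite leNgt; apply/negP => lt.
have [|d d0 hd] := @poly_cont _ x (q - p) (p.[x] - q.[x]); first by rewrite subr_gt0.
pose y := Num.min 0 (x + d / 2).
have xy : x < y by rewrite /y lt_min x0 ltrDl divr_gt0.
have yd : y - x < d.
  have : y <= x + d / 2 by rewrite /y ge_min lexx orbT.
  by move=> ?; lra.
have := hd y; rewrite gtr0_norm ?subr_gt0 // => /(_ yd).
have := h y; rewrite xy /= /y ge_min lexx => /(_ isT); rewrite -/y !hornerE => h1.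
have := ler_norm ((q.[y] - p.[y]) - (q.[x] - p.[x])) => h2 h3.
by lra.
Qed.

Lemma pos_on_le0 x p y : pos_on x p -> x <= y <= 0 -> x < 0 -> 0 <= p.[y].
Proof.
move=> h; rewrite le_eqVlt => /andP[/orP[/eqP<- _|xy y0] x0].
  have := @horner_le_closed x 0 p x0; rewrite horner0; apply => z hz.
  by rewrite horner0 ltW // h.
by rewrite ltW // h // xy y0.
Qed.

(** The starting point of arguments by contradiction: [p] vanishes at [r] and is positive to the
    right of it, so both facts can be used at one point. *)
Lemma largest_nonpos_root p y : 0 < p.[0] -> p.[y] <= 0 -> y <= 0 ->
  exists2 r, y <= r < 0 & root p r /\ pos_on r p.
Proof.
move=> p0 py y0.
have yn0 : y < 0 by rewrite lt_neqAle y0 andbT; apply: contraTneq py => ->; rewrite -ltNge.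
have pn0 : p != 0 by apply: contraTneq p0 => ->; rewrite horner0 ltxx.
have pos r : {in `]r, 0[, forall z, ~~ root p z} -> pos_on r p.
  move=> nr z /andP[rz z0]; rewrite ltNge; apply/negP => pz.
  have zn0 : z < 0 by rewrite lt_neqAle z0 andbT; apply: contraTneq pz => ->; rewrite -ltNge.
  have [|c cz rc] := @polyrcf.poly_ivt _ p z 0 z0; first by rewrite pmulr_lle0.
  move: cz; rewrite in_itv /= => /andP[zc c0].
  have cn0 : c < 0.
    by rewrite lt_neqAle c0 andbT; apply: contraTneq rc => ->; rewrite rootE gt_eqF.
  by have := nr c; rewrite in_itv /= cn0 (lt_le_trans rz zc) rc => /(_ isT).
(* The last root strictly between [y] and 0 is sought. If there is none, [p] is positive there, so
   [p.[y] >= 0] by continuity and [y] itself is the root. *)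
have := @prev_rootP _ p y 0; case=> [p00|r _ pr ry nr|c _ _ nr].
- by rewrite p00 eqxx in pn0.
- exists r; last by split; [apply/rootP|apply: pos].
  by move: ry; rewrite in_itv /= => /andP[/ltW-> ->].
- exists y; first by rewrite lexx.
  split; last exact: pos.
  have h : 0 <= p.[y] by apply: (pos_on_le0 (pos _ nr)) => //; rewrite lexx.
  by apply/rootP/eqP; rewrite eq_le py h.
Qed.

End PositivityOnIntervals.

(** * Positivity and antitonicity under induced subgraphs *)

Section PositivityOfSubgraphs.
Variables (R : rcfType) (T : finType) (e : rel T).
Hypotheses (e_sym : symmetric e) (e_irr : irreflexive e).
Implicit Types (S : {set T}) (x y : R).
Local Notation I S := (ipoly R e S).

Lemma ipoly_at0 S : (I S).[0] = 1.
Proof.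
rewrite /ipoly horner_sum (bigD1 set0) /=; last first.
  by rewrite sub0set; apply/indepP => x y; rewrite inE.
rewrite cards0 expr0 hornerE big1 ?addr0 // => A /andP[_ A0].
by rewrite hornerXn expr0n cards_eq0 (negPf A0).
Qed.

(* At the largest root [r] of I(S \ v) the recursion reads
   I(S) = r * I(S \ N[v]), and I(S \ N[v]) is nonnegative there. *)
Lemma pos_on_sub S S' x : S' \subset S -> pos_on x (I S) -> pos_on x (I S').
Proof.
elim/(@ltn_ind): {S}#|S| {-2}S (erefl #|S|) S' x => n IH S cS S' x sS hS.
case: (eqVneq S' S) => [->//|nS].
have [v vS vS'] : exists2 v, v \in S & v \notin S'.
  by apply/subsetPn; apply: contra nS => h; rewrite eqEsubset sS.
have c1 : (#|S :\ v| < n)%N by rewrite -cS (cardsD1 v S) vS.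
have s1 : S' \subset S :\ v by rewrite subsetD1 sS.
apply: (IH _ c1 _ erefl _ _ s1) => y /andP[xy y0].
rewrite ltNge; apply/negP => hy.
have [|r /andP[yr r0] [rr pr]] := @largest_nonpos_root _ (I (S :\ v)) y _ hy y0.
  by rewrite ipoly_at0.
have s2 : S :\: cnbhd e v \subset S :\ v by rewrite setDS // sub1set !inE eqxx.
have p2 := IH _ c1 _ erefl _ _ s2 pr.
have := pos_on_le0 p2 (y := r); rewrite lexx ltW // => /(_ isT r0) h.
have := hS r; rewrite (lt_le_trans xy yr) ltW // => /(_ isT).
rewrite (ipolyD1 _ e_sym e_irr vS) !hornerE (rootP rr) add0r ltNge.
by rewrite mulr_le0_ge0 // ltW.
Qed.

(** The vertices of [S] outside [S'] are removed one at a time. Removing [v] changes the value by [-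
    y * I(S - N[v])], which is nonnegative since [y <= 0] and positivity passes to [S - N[v]]. *)
Lemma ipoly_antimono S S' x y : S' \subset S -> pos_on x (I S) -> x < y <= 0 ->
  (I S).[y] <= (I S').[y].
Proof.
move=> sS hS hy; have /andP[_ y0] := hy.
elim: {S}#|S| {-2}S (erefl #|S|) sS hS => [|n IH] S cS sS hS.
  have -> : S = set0 by apply/eqP; rewrite -cards_eq0 cS.
  suff -> : S' = set0 by [].
  apply/eqP; rewrite -subset0; move: sS.
  by have -> : S = set0 by apply/eqP; rewrite -cards_eq0 cS.
case: (eqVneq S' S) => [->//|nS].
have [v vS vS'] : exists2 v, v \in S & v \notin S'.
  by apply/subsetPn; apply: contra nS => h; rewrite eqEsubset sS.
have hD : pos_on x (I (S :\ v)) by apply: pos_on_sub hS; rewrite subsetDl.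
apply: le_trans (IH _ _ _ hD); last 2 first.
- by move: cS; rewrite (cardsD1 v S) vS => -[].
- by rewrite subsetD1 sS.
rewrite (ipolyD1 _ e_sym e_irr vS) !hornerE gerDl mulr_le0_ge0 // ltW //.
by apply: (pos_on_sub _ hS) hy; rewrite subsetDl.
Qed.

End PositivityOfSubgraphs.

(** * Path and cycle polynomials *)

Section FibonacciPolynomials.
Variable R : rcfType.
Implicit Types a b : {poly R}.

Fixpoint fibp a b n : {poly R} :=
  match n with
  | 0 => a
  | n1.+1 => if n1 is n2.+1 then fibp a b n1 + 'X * fibp a b n2 else b
  end.

(* [path_poly n] is I(P_(n-1)), with the convention I(P_(-1)) = 1. *)
Definition path_poly n := fibp 1 1 n.

(* [lucas_poly n] is I(C_n) for n >= 3. *)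
Definition lucas_poly n := fibp 2 1 n.

Lemma path_polySS n : path_poly n.+2 = path_poly n.+1 + 'X * path_poly n.
Proof. by []. Qed.

Lemma lucas_polySS n : lucas_poly n.+2 = lucas_poly n.+1 + 'X * lucas_poly n.
Proof. by []. Qed.

(** The vertex recursion for a cycle on [n + 2] vertices: deleting a vertex leaves a path on [n + 1]
    vertices, deleting its closed neighbourhood one on [n - 1]. Two consecutive cases are proved
    together because the recursion has order two. *)
Lemma lucas_pathE n : lucas_poly n.+2 = path_poly n.+2 + 'X * path_poly n.
Proof.
suff : lucas_poly n.+2 = path_poly n.+2 + 'X * path_poly n /\
       lucas_poly n.+3 = path_poly n.+3 + 'X * path_poly n.+1 by case.
elim: n => [|n [IH1 IH2]]; last first.
  split=> //; rewrite lucas_polySS IH2 IH1 (path_polySS n.+2) (path_polySS n) !path_polySS.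
  ring.
by rewrite /lucas_poly /path_poly /=; split; ring.
Qed.

End FibonacciPolynomials.

(** * Paths hanging from a vertex *)

Section Chains.
Variables (R : rcfType) (T : finType) (e : rel T).
Hypotheses (e_sym : symmetric e) (e_irr : irreflexive e).
Implicit Types (S K : {set T}) (p q s : seq T).
Local Notation I S := (ipoly R e S).
Local Notation P := (path_poly R).

(* [p] is a path hanging from the vertex [w] of [K], each of its vertices being
   joined, among the previous ones, to its predecessor only. *)
Fixpoint chain K w p : bool :=
  if p is v :: q then
    [&& v \notin K, w \in K, [forall y in K, e v y == (y == w)] & chain (v |: K) v q]
  else true.

Lemma set_seq_cons v q : [set x in v :: q] = v |: [set x in q].
Proof. by apply/setP => x; rewrite !inE. Qed.

Lemma set_seq_nil : [set x in [::]] = set0 :> {set T}.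
Proof. by apply/setP => x; rewrite !inE. Qed.

(** The subset [K'] is free so that the formula applies after vertices of [K] have been deleted. If
    [w] is gone, the path is a separate component; otherwise the recursion at [w] applies, and
    choosing [w] forbids the first vertex of the path. The convention [P 0 = 1] covers the empty
    path. *)
Lemma ipoly_chain K K' w p : chain K w p -> K' \subset K ->
  I (K' :|: [set x in p]) =
  if w \in K' then P (size p).+1 * I (K' :\ w) + 'X * P (size p) * I (K' :\: cnbhd e w)
  else P (size p).+1 * I K'.
Proof.
elim: p K K' w => [|v q IH] K K' w /=.
  move=> _ sK; rewrite set_seq_nil setU0; case: ifP => wK; last by rewrite mul1r.
  by rewrite (ipolyD1 _ e_sym e_irr wK) /path_poly /= mul1r mulr1.
case/and4P=> vK wK /forall_inP hv hq sK.
have vK' : v \notin K' by apply: contra vK; apply: subsetP.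
rewrite set_seq_cons setUCA setUA (IH _ _ _ hq); last by rewrite setUS.
rewrite setU11 setU1K //.
have -> : (v |: K') :\: cnbhd e v = K' :\ w.
  apply/setP => y; rewrite !inE.
  case: (y =P v) => [->|_] /=; first by rewrite (negPf vK') andbF.
  case: (boolP (y \in K')) => yK; rewrite ?andbF // !andbT.
  by rewrite (eqP (hv y (subsetP sK _ yK))).
case: ifP => wK'.
  rewrite (ipolyD1 _ e_sym e_irr wK') path_polySS; ring.
have -> : K' :\ w = K' by apply/setDidPl; rewrite disjoint_sym disjoints1 wK'.
rewrite path_polySS; ring.
Qed.

Lemma ipoly_chain0 K w p : chain K w p -> I [set x in p] = P (size p).+1.
Proof.
by move=> h; have := ipoly_chain h (sub0set _); rewrite set0U inE ipoly0 mulr1.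
Qed.

Lemma chain_cat K w p q :
  chain K w (p ++ q) = chain K w p && chain (K :|: [set x in p]) (last w p) q.
Proof.
elim: p K w => [|v p IH] K w /=; first by rewrite set_seq_nil setU0.
by rewrite IH set_seq_cons setUCA setUA -!andbA.
Qed.

Lemma chain_uniq K w p : chain K w p -> uniq p /\ [disjoint [set x in p] & K].
Proof.
elim: p K w => [|v p IH] K w /=.
  by rewrite set_seq_nil; split=> //; rewrite disjoints_subset sub0set.
case/and4P=> vK _ _ /IH[-> d].
rewrite set_seq_cons; move: d; rewrite !disjoints_subset => /subsetP d.
split.
  rewrite andbT; apply/negP => vp; have := d v.
  by rewrite !inE vp eqxx => /(_ isT).
apply/subsetP => x; rewrite inE => /orP[/set1P->|/d]; first by rewrite inE.
by rewrite !inE negb_or => /andP[].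
Qed.

Lemma chain_of_nth s1 w q : uniq (rcons s1 w ++ q) ->
  (forall i j, (i < j < size (rcons s1 w ++ q))%N ->
     e (nth w (rcons s1 w ++ q) j) (nth w (rcons s1 w ++ q) i) = (j == i.+1)) ->
  chain [set x in rcons s1 w] w q.
Proof.
elim: q s1 w => [|v q IH] s1 w //= us hs.
have ev : rcons (rcons s1 w) v ++ q = rcons s1 w ++ v :: q by rewrite cat_rcons.
have sv : v \notin rcons s1 w.
  by move: us; rewrite cat_uniq /= => /and4P[_ /norP[]].
apply/and4P; split.
- by rewrite inE.
- by rewrite inE mem_rcons inE eqxx.
- apply/forall_inP => y; rewrite inE => ys.
  have hi : (index y (rcons s1 w) < size (rcons s1 w))%N by rewrite index_mem.
  have := hs (index y (rcons s1 w)) (size (rcons s1 w)).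
  rewrite hi size_cat /= addnS ltnS leq_addr => /(_ isT).
  rewrite !nth_cat ltnn subnn hi /= nth_index // => ->.
  apply/eqP; rewrite size_rcons eqSS.
  have uw : uniq (rcons s1 w) by move: us; rewrite cat_uniq => /andP[].
  have {1}-> : size s1 = index w (rcons s1 w).
    by move: uw; rewrite rcons_uniq -cats1 index_cat => /andP[/negPf-> _]; rewrite /= eqxx addn0.
  rewrite eq_sym; apply/eqP/eqP => [|->//].
  by move/(congr1 (nth w (rcons s1 w))); rewrite !nth_index // mem_rcons inE eqxx.
have -> : v |: [set x in rcons s1 w] = [set x in rcons (rcons s1 w) v].
  by apply/setP => x; rewrite !inE (mem_rcons _ v) inE.
apply: IH; first by rewrite ev.
rewrite ev => i j hij; rewrite -hs //.
case/andP: hij => ij js.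
by rewrite !(set_nth_default w v) // (ltn_trans ij).
Qed.

End Chains.

(** * Cycles with leaves, and the polynomial of a cycle *)

Section Shapes.
Variables (T : finType) (e : rel T).
Implicit Types (S K : {set T}) (p q s : seq T) (r : rel nat).

Definition cycle_rel k : rel nat :=
  fun i j => (j == i.+1 %% k)%N || (i == j.+1 %% k)%N.

(** [s] lists an induced copy of the graph [r] on [0, ..., size s - 1]; [x0] is quantified so that
    any default of [nth] may be supplied. *)
Definition shaped r s :=
  uniq s /\ forall x0 i j, (i < size s)%N -> (j < size s)%N ->
    e (nth x0 s i) (nth x0 s j) = r i j.

(** A construction history inside a fixed graph: [S] holds the vertices present so far, and the new
    leaf [v] has a single neighbour in [S], whatever its adjacencies to vertices still to come. *)
Inductive unicyc : {set T} -> Prop :=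
| UnicycCycle s : (2 < size s)%N -> shaped (cycle_rel (size s)) s ->
    unicyc [set x in s]
| UnicycLeaf S u v : unicyc S -> u \in S -> v \notin S ->
    (forall y, y \in S -> e v y = (y == u)) -> unicyc (v |: S).

Lemma unicyc_card S : unicyc S -> (2 < #|S|)%N.
Proof.
elim=> [s s2 [us _]|S' u v _ IH _ vS _]; first by rewrite cardsE (card_uniqP us).
by rewrite cardsU1 vS ltnW.
Qed.

End Shapes.

Section CyclePolynomial.
Variables (R : rcfType) (T : finType) (e : rel T).
Hypotheses (e_sym : symmetric e) (e_irr : irreflexive e).

(** The list is read as [a :: v :: rcons q' l]. Deleting [a] leaves a path with ends [v] and [l],
    which are the neighbours of [a], so deleting its closed neighbourhood leaves the path [q']. *)
Lemma ipoly_cycle (s : seq T) : (2 < size s)%N -> shaped e (cycle_rel (size s)) s ->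
  ipoly R e [set x in s] = lucas_poly R (size s).
Proof.
case: s => [//|a [//|v q]]; case: (lastP q) => [//|q' l] _ [us hs].
have ks : size (a :: v :: rcons q' l) = (size q').+3 by rewrite /= size_rcons.
have hch : chain e [set v] v (rcons q' l).
  have := @chain_of_nth _ e [::] v (rcons q' l); rewrite /= set_seq_cons set_seq_nil setU0.
  apply; first by case/andP: us.
  move=> i j /andP[ij js].
  have := hs v j.+1 i.+1; rewrite ks /= => ->; last 2 first.
  - by move: js; rewrite size_rcons.
  - by rewrite ltnS (ltn_trans ij) //; move: js; rewrite size_rcons.
  move: js; rewrite size_rcons /cycle_rel => js.
  rewrite (modn_small (m := i.+2)); last by lia.
  have [jk|jk] := eqVneq j.+2 (size q').+3; first by rewrite jk modnn; lia.
  by rewrite modn_small; lia.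
have aS : a \in [set x in a :: v :: rcons q' l] by rewrite !inE eqxx.
rewrite (ipolyD1 _ e_sym e_irr aS).
have -> : [set x in a :: v :: rcons q' l] :\ a = v |: [set x in rcons q' l].
  rewrite set_seq_cons setU1K; first by rewrite set_seq_cons.
  by rewrite inE; case/andP: us.
rewrite (ipoly_chain _ e_sym e_irr hch) ?set11 ?setDv ?ipoly0; last first.
  by rewrite subxx.
have -> : [set v] :\: cnbhd e v = set0.
  by apply/setP => y; rewrite !inE; case: eqP; rewrite ?andbF.
have -> : [set x in a :: v :: rcons q' l] :\: cnbhd e a = [set x in q'].
  have eav : e a v.
    by have := hs a 0%N 1%N; rewrite ks => /(_ isT isT) /= ->; rewrite /cycle_rel modn_small.
  have eal : e a l.
    have := hs a 0%N (size q').+2; rewrite ks => /(_ isT (ltnSn _)) /=.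
    by rewrite nth_rcons ltnn eqxx => ->; rewrite /cycle_rel modnn orbT.
  have eaq y : y \in q' -> e a y = false.
    move=> yq; have iq : (index y q' < size q')%N by rewrite index_mem.
    have := hs a 0%N (index y q').+2; rewrite ks !ltnS => /(_ isT (ltnW iq)) /=.
    rewrite nth_rcons iq nth_index // => ->.
    by rewrite /cycle_rel !modn_small //; lia.
  apply/setP => y; rewrite !inE mem_rcons inE.
  move: us; rewrite /= !inE !mem_rcons !inE !negb_or rcons_uniq.
  case/and4P=> /and3P[av al aq] /andP[vl vq] lq uq.
  apply/idP/idP => [/andP[/andP[/negPf-> ne] /= /or3P[/eqP yv|/eqP yl|//]]|yq].
  - by rewrite yv eav in ne.
  - by rewrite yl eal in ne.
  rewrite yq !orbT andbT eaq // andbT.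
  by apply: contraNneq aq => <-.
rewrite (ipoly_chain0 _ e_sym e_irr (K := [set v]) (w := v)); last first.
  by move: hch; rewrite -cats1 chain_cat => /andP[].
rewrite ipoly0 ks lucas_pathE size_rcons (path_polySS _ (size q').+1) !path_polySS; ring.
Qed.

End CyclePolynomial.

(** * Upper bound: the polynomials of [U_n] against those of cycles *)

Section UpperFamily.
Variable R : rcfType.
Implicit Types (x y : R).

(* I of an edge together with [m] isolated vertices. *)
Definition edge_poly m : {poly R} := (1 + 2%:R *: 'X) * (1 + 'X) ^+ m.

(* I(U_(m + 3)). *)
Definition star_poly m : {poly R} := edge_poly m + 'X.

Local Notation L := (lucas_poly R).

Lemma edge_polyS m : edge_poly m.+1 = (1 + 'X) * edge_poly m.
Proof. by rewrite /edge_poly exprS; ring. Qed.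

Lemma star_polyS m : star_poly m.+1 = star_poly m + 'X * edge_poly m.
Proof. by rewrite /star_poly edge_polyS; ring. Qed.

Lemma edge_polyS_at m y : (edge_poly m.+1).[y] = (1 + y) * (edge_poly m).[y].
Proof. by rewrite edge_polyS hornerM hornerD hornerC hornerX. Qed.

Lemma star_polyS_at m y :
  (star_poly m.+1).[y] = (star_poly m).[y] + y * (edge_poly m).[y].
Proof. by rewrite star_polyS hornerD hornerM hornerX. Qed.

Lemma lucas_polySS_at m y : (L m.+2).[y] = (L m.+1).[y] + y * (L m).[y].
Proof. by rewrite lucas_polySS hornerD hornerM hornerX. Qed.

(** At [-1/2] the factor [1 + 2X] vanishes and [star_poly] takes the value [-1/2], so no interval of
    positivity reaches that point. *)
Lemma star_poly_range x y m : pos_on x (star_poly m) -> x < y <= 0 -> 0 < 1 + 2 * y.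
Proof.
move=> h /andP[xy y0]; rewrite ltNge; apply/negP => hy.
have := h (- 2^-1); rewrite /star_poly /edge_poly !hornerE.
have -> : 1 + 2 * - 2^-1 = 0 :> R by field.
rewrite mul0r add0r => h2.
suff : 0 < - 2^-1 :> R by lra.
by apply: h2; apply/andP; split; lra.
Qed.

Lemma edge_poly_ge0 y m : 0 < 1 + 2 * y -> 0 <= (edge_poly m).[y].
Proof.
move=> h; rewrite /edge_poly !hornerE mulr_ge0 ?(ltW h) //.
by rewrite exprn_ge0 //; lra.
Qed.

Lemma star_poly_pos_pred x m : pos_on x (star_poly m.+1) -> pos_on x (star_poly m).
Proof.
move=> h y hy; have := h y hy; rewrite star_polyS_at => h1.
have h2 := edge_poly_ge0 m (star_poly_range h hy).
have : y * (edge_poly m).[y] <= 0.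
  by rewrite mulr_le0_ge0 //; case/andP: hy.
by move: h1; lra.
Qed.

(** The four claims support each other. As [y <= 0], the step for [star_poly] needs
    [L m.+2 <= edge_poly m]; the step for the latter multiplies by [1 + y] and needs
    [L m.+2 <= L m.+1], hence [L m >= 0]. Nonnegativity of [L m.+2] comes back from
    [L m.+3 >= star_poly m > 0]. *)
Lemma star_poly_le_lucas x y m : pos_on x (star_poly m) -> x < y <= 0 ->
  [/\ (star_poly m).[y] <= (L m.+3).[y], (L m.+2).[y] <= (edge_poly m).[y],
      0 <= (L m.+1).[y] & 0 <= (L m).[y]].
Proof.
move=> + hy; have /andP[_ y0] := hy.
elim: m => [|m IH] hm.
  rewrite /star_poly /edge_poly /lucas_poly /= expr0 !hornerE.
  by split; lra.
have hm' := star_poly_pos_pred hm.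
have [h1 h2 h3 h4] := IH hm'.
have u0 := hm' y hy.
have r0 := star_poly_range hm hy.
have e2 := lucas_polySS_at m y; have e3 := lucas_polySS_at m.+1 y.
have p1 := hm' y hy.
have q1 := mulr_le0_ge0 y0 h3; have q2 := mulr_le0_ge0 y0 h4.
have l2 : 0 <= (L m.+2).[y] by lra.
rewrite star_polyS_at edge_polyS_at (lucas_polySS_at m.+2).
split=> //; first by have := ler_wnM2l y0 h2; lra.
have h5 : (1 + y) * (L m.+2).[y] <= (1 + y) * (edge_poly m).[y].
  by rewrite ler_wpM2l //; lra.
have h6 : y * (L m.+1).[y] <= y * (L m.+2).[y] by rewrite ler_wnM2l //; lra.
by lra.
Qed.

End UpperFamily.

(** * Upper bound: adding leaves *)

Section UpperBound.
Variables (R : rcfType) (T : finType) (e : rel T).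
Hypotheses (e_sym : symmetric e) (e_irr : irreflexive e).
Implicit Types (S K : {set T}) (x y : R).
Local Notation I S := (ipoly R e S).

Lemma ipoly1 v : I [set v] = 1 + 'X.
Proof.
rewrite (ipolyD1 _ e_sym e_irr (set11 v)) setDv ipoly0.
have -> : [set v] :\: cnbhd e v = set0 by apply/setP => z; rewrite !inE; case: eqP; rewrite ?andbF.
by rewrite ipoly0 mulr1.
Qed.

Lemma ipoly_edge a b : e a b -> I [set a; b] = edge_poly R 0.
Proof.
move=> eab; have ab : a != b by apply: contraTneq eab => ->; rewrite e_irr.
rewrite (ipolyD1 _ e_sym e_irr (set21 a b)) setU1K ?inE // ipoly1.
have -> : [set a; b] :\: cnbhd e a = set0.
  apply/setP => z; rewrite !inE; case: (z =P a) => //= _.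
  by case: (z =P b) => [->|_]; rewrite ?eab ?andbF.
by rewrite ipoly0 /edge_poly expr0 scaler_nat; ring.
Qed.

Lemma edge_superset_ind (P : {set T} -> Prop) a b : a != b ->
  P [set a; b] ->
  (forall K v, a \in K -> b \in K -> v \notin K -> P K -> P (v |: K)) ->
  forall K, a \in K -> b \in K -> P K.
Proof.
move=> ab P0 PS K; elim: {K}#|K| {-2}K (erefl #|K|) => [|n IH] K cK aK bK.
  by move/eqP: cK; rewrite cards_eq0 => /eqP K0; rewrite K0 inE in aK.
have sK : [set a; b] \subset K by apply/subsetP => z; rewrite !inE => /orP[]/eqP->.
have [->//|nK] := eqVneq K [set a; b].
have [v vK vab] : exists2 v, v \in K & v \notin [set a; b].
  by apply/subsetPn; apply: contra nK => h; rewrite eqEsubset sK h.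
rewrite -(setD1K vK); move: vab; rewrite !inE negb_or => /andP[va vb].
have aK' : a \in K :\ v by rewrite !inE eq_sym va.
have bK' : b \in K :\ v by rewrite !inE eq_sym vb.
apply: PS => //; first by rewrite !inE eqxx.
by apply: IH => //; move: cK; rewrite (cardsD1 v K) vK => -[].
Qed.

(** Each vertex beyond [a] and [b] multiplies the bound by [1 + y]: adding [v] adds [y] times the
    polynomial of a subgraph of [K], which is at least that of [K]. *)
Lemma ipoly_le_edge x y K a b : e a b -> a \in K -> b \in K ->
  pos_on x (I K) -> x < y <= 0 -> (I K).[y] <= (edge_poly R (#|K| - 2)).[y].
Proof.
move=> eab aK bK + hy; have /andP[_ y0] := hy.
have ab : a != b by apply: contraTneq eab => ->; rewrite e_irr.
move: K aK bK; apply: (edge_superset_ind ab) => [|K v aK bK vK IH hK].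
  by rewrite cards2 ab ipoly_edge.
have hK' : pos_on x (I K) by apply: (pos_on_sub e_sym e_irr _ hK); apply: subsetUr.
have cK : (1 < #|K|)%N.
  by rewrite (cardD1 a) (cardD1 b) !inE /= aK bK eq_sym ab.
rewrite cardsU1 vK /= -addnBA // add1n edge_polyS_at.
rewrite (ipolyD1 _ e_sym e_irr (setU11 v K)) setU1K // hornerD hornerM hornerX.
have sK : (v |: K) :\: cnbhd e v \subset K.
  by apply/subsetP => z; rewrite !inE negb_or => /andP[/andP[/negPf->]].
have h1 := ipoly_antimono e_sym e_irr sK hK' hy.
have h2 := IH hK'.
(* [1 + y] is the value of the one-vertex subgraph [v]. *)
have h3 : 0 < 1 + y.
  have := pos_on_sub e_sym e_irr (S' := [set v]) _ hK; rewrite sub1set setU11.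
  by move=> /(_ isT y hy); rewrite ipoly1 !hornerE.
have := ler_wnM2l y0 h1; have : (1 + y) * (I K).[y] <= (1 + y) * (edge_poly R (#|K| - 2)).[y].
  by rewrite ler_wpM2l // ltW.
by lra.
Qed.

Lemma ipoly_edge_isolated K a b : e a b -> a \in K -> b \in K ->
  (forall v z, v \in K -> z \in K -> v != a -> v != b -> ~~ e v z) ->
  I K = edge_poly R (#|K| - 2).
Proof.
move=> eab; have ab : a != b by apply: contraTneq eab => ->; rewrite e_irr.
move: K; apply: (edge_superset_ind ab) => [_|K v aK bK vK IH hK].
  by rewrite cards2 ab ipoly_edge.
have cK : (1 < #|K|)%N.
  by rewrite (cardD1 a) (cardD1 b) !inE /= aK bK eq_sym ab.
rewrite cardsU1 vK /= -addnBA // add1n edge_polyS.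
rewrite (ipolyD1 _ e_sym e_irr (setU11 v K)) setU1K //.
have -> : (v |: K) :\: cnbhd e v = K.
  apply/setP => z; rewrite !inE; case: (z =P v) => [->|/eqP zv] /=; first by rewrite (negPf vK).
  case: (boolP (z \in K)) => zK; rewrite ?andbF // andbT.
  apply: hK; rewrite ?inE ?eqxx ?zK ?orbT //.
    by apply: contraNneq vK => ->.
  by apply: contraNneq vK => ->.
rewrite IH; first by ring.
by move=> w z wK zK; apply: hK; rewrite inE ?wK ?zK orbT.
Qed.

(** A cycle of length at least 3 keeps an edge after the loss of one vertex; this supplies the edge
    of [ipoly_le_edge] in [S - u]. The cases are [u] at position 0, at position 1, or elsewhere. *)
Lemma unicyc_edge S u : unicyc e S ->
  exists a b, [/\ a \in S :\ u, b \in S :\ u & e a b].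
Proof.
elim=> [s s2 [us hs]|S' w v _ [a [b [aS bS eab]]] _ _ _]; last first.
  have sub : S' :\ u \subset (v |: S') :\ u by rewrite setSD // subsetUr.
  by exists a, b; split=> //; apply: (subsetP sub).
suff [i [j [hi hj]]] : exists i j, [/\ (i < size s)%N, (j < size s)%N,
    nth u s i != u & nth u s j != u /\ cycle_rel (size s) i j].
  move=> iu [ju cij]; exists (nth u s i), (nth u s j).
  by rewrite !inE !mem_nth // iu ju hs.
have nu i : (i < size s)%N -> i != index u s -> nth u s i != u.
  move=> hi; apply: contraNneq => <-.
  by rewrite index_uniq.
have [u0|u0] := eqVneq (index u s) 0%N.
  exists 1%N, 2%N; split=> //; try (apply: nu; rewrite ?u0 //; lia); first lia.
  split; first by apply: nu; rewrite ?u0.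
  by rewrite /cycle_rel (modn_small (m := 2)).
have [u1|u1] := eqVneq (index u s) 1%N.
  exists 0%N, (size s).-1; split; [lia|lia| |split].
  - by apply: nu; rewrite ?u1 //; lia.
  - by apply: nu; rewrite ?u1 //; lia.
  - by rewrite /cycle_rel prednK ?modnn ?orbT //; lia.
exists 0%N, 1%N; split; [lia|lia| |split].
- by apply: nu; rewrite 1?eq_sym //; lia.
- by apply: nu; rewrite 1?eq_sym //; lia.
- by rewrite /cycle_rel modn_small //; lia.
Qed.

Lemma ipolyU1_leaf S u v : u \in S -> v \notin S ->
  (forall z, z \in S -> e v z = (z == u)) ->
  I (v |: S) = I S + 'X * I (S :\ u).
Proof.
move=> uS vS hv; rewrite (ipolyD1 _ e_sym e_irr (setU11 v S)) setU1K //.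
congr (_ + _ * ipoly _ _ _).
apply/setP => z; rewrite !inE; case: (z =P v) => [->|_] /=; first by rewrite (negPf vS) andbF.
by case: (boolP (z \in S)) => zS; rewrite ?andbF // !andbT hv.
Qed.

(** A leaf at [u] adds [y * I(S - u)] on one side and [y * edge_poly] on the other, both on
    [|S| - 1] vertices. Only the star is assumed positive; as [y] is general in the induction,
    positivity of the smaller graph on the whole interval comes from the induction hypothesis. *)
Lemma star_poly_le_unicyc S x y : unicyc e S -> pos_on x (star_poly R (#|S| - 3)) ->
  x < y <= 0 -> (star_poly R (#|S| - 3)).[y] <= (I S).[y].
Proof.
move=> uS; elim: uS y => [s s2 hs|S' u v uS' IH uS vS hv] y hS hy.
  rewrite (ipoly_cycle R e_sym e_irr s2 hs).
  case: hs => us _; move: hS; rewrite cardsE (card_uniqP us) => hS.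
  have sE : ((size s - 3).+3 = size s)%N by lia.
  by have [] := star_poly_le_lucas hS hy; rewrite sE.
have c3 := unicyc_card uS'.
move: hS; rewrite cardsU1 vS /= -addnBA // add1n => hS.
have hS' := star_poly_pos_pred hS.
have hpos : pos_on x (I S') by move=> z hz; apply: lt_le_trans (hS' z hz) (IH z hS' hz).
have [a [b [aS bS eab]]] := unicyc_edge u uS'.
have := ipoly_le_edge eab aS bS (pos_on_sub e_sym e_irr (subD1set S' u) hpos) hy.
have -> : (#|S' :\ u| - 2 = #|S'| - 3)%N by rewrite (cardsD1 u S') uS add1n subSS.
have := IH y hS' hy; case/andP: hy => _ y0 h1 h2.
have -> : (I (v |: S')).[y] = (I S').[y] + y * (I (S' :\ u)).[y].
  by rewrite (ipolyU1_leaf uS vS hv) hornerD hornerM hornerX.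
by rewrite star_polyS_at; have := ler_wnM2l y0 h2; lra.
Qed.

End UpperBound.

(** * Lower bound: degrees and connectedness *)

Lemma modnS_lt i k : (i < k)%N -> (i.+1 %% k)%N = if i.+1 == k then 0%N else i.+1.
Proof.
move=> ik; case: eqP => [->|/eqP ne]; first by rewrite modnn.
by rewrite modn_small // ltn_neqAle ne.
Qed.

Lemma cycle_relE k i j : (2 < k)%N -> (i < k)%N -> (j < k)%N ->
  cycle_rel k i j =
  (j == if i.+1 == k then 0 else i.+1)%N || (j == if i == 0 then k.-1 else i.-1)%N.
Proof.
move=> k2 ik jk; rewrite /cycle_rel !modnS_lt //; congr (_ || _).
by case: (j.+1 =P k); case: (i =P 0%N); lia.
Qed.

Section Degrees.
Variables (T : finType) (e : rel T).
Hypotheses (e_sym : symmetric e) (e_irr : irreflexive e).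
Implicit Types (S A K : {set T}).

Definition deg S v := #|[set y in S | e v y]|.

(* Connectedness of the subgraph induced by [S], in terms of cuts. *)
Definition connected_on S := forall A : {set T}, A \subset S -> A != set0 ->
  (forall a b, a \in A -> b \in S -> e a b -> b \in A) -> A = S.

(** By handshaking, as many edges as vertices: with [connected_on] this expresses unicyclicity
    without mentioning a cycle. *)
Definition degree_sum2 S := (\sum_(v in S) deg S v = 2 * #|S|)%N.

Section AddLeaf.
Variables (S : {set T}) (u v : T).
Hypotheses (uS : u \in S) (vS : v \notin S).
Hypothesis hv : forall y, y \in S -> e v y = (y == u).

Lemma connected_on_add_leaf : connected_on S -> connected_on (v |: S).
Proof.
move=> cS A sA A0 cA.
have uA : v \in A -> u \in A by move=> vA; apply: (cA v); rewrite ?inE ?uS ?orbT ?hv.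
have AS : A :&: S = S.
  apply: cS; first exact: subsetIr.
    have /set0Pn[a aA] := A0; apply/set0Pn.
    have := subsetP sA a aA; rewrite !inE => /orP[/eqP av|aS]; last by exists a; rewrite inE aA.
    by exists u; rewrite inE uS andbT uA // -av.
  move=> a b; rewrite !inE => /andP[aA aS] bS eab.
  by rewrite bS andbT (cA a) // inE bS orbT.
apply/eqP; rewrite eqEsubset sA /=; apply/subsetP => x; rewrite !inE.
case/orP=> [/eqP->|xS]; last by move: xS; rewrite -{1}AS inE => /andP[].
have uA' : u \in A by move: uS; rewrite -{1}AS inE => /andP[].
by apply: (cA u) => //; rewrite ?setU11 // e_sym hv.
Qed.

Lemma connected_on_del_leaf : connected_on (v |: S) -> connected_on S.
Proof.
move=> cS A sA A0 cA; have vA : v \notin A by apply: contra vS; apply: subsetP.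
case: (boolP (u \in A)) => uA.
  have : v |: A = v |: S.
    apply: cS; first by rewrite setUS.
      by apply/set0Pn; exists v; rewrite setU11.
    move=> a b; rewrite !inE => /orP[/eqP->|aA] /orP[/eqP->|bS] eab; rewrite ?eqxx //.
      by move: eab; rewrite hv // => /eqP->; rewrite uA orbT.
    by rewrite (cA a) ?orbT.
  by move/(congr1 (fun B => B :\ v)); rewrite !setU1K.
have : A = v |: S.
  apply: cS => //; first by rewrite subsetU // sA orbT.
  move=> a b aA; rewrite !inE => /orP[/eqP->|bS] eab; last exact: (cA a).
  by move: eab; rewrite e_sym hv ?(subsetP sA) // => /eqP au; rewrite -au aA in uA.
by move=> h; rewrite h setU11 in vA.
Qed.

Lemma deg_leaf : deg (v |: S) v = 1%N.
Proof.
rewrite /deg; have -> : [set y in v |: S | e v y] = [set u]; last by rewrite cards1.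
apply/setP => y; rewrite !inE; case: (y =P v) => [->|_] /=.
  by rewrite e_irr; apply/esym/negP => /eqP vu; move: vS; rewrite vu uS.
case: (boolP (y \in S)) => [/hv->//|yS] /=.
by apply/esym; apply: contraNF yS => /eqP->.
Qed.

Lemma deg_add_leaf x : x \in S -> deg (v |: S) x = (deg S x + (x == u))%N.
Proof.
move=> xS; rewrite /deg addnC -hv // e_sym.
have -> : [set y in v |: S | e x y] =
  if e x v then v |: [set y in S | e x y] else [set y in S | e x y].
  apply/setP => y; case: ifP => exv; rewrite !inE;
  by case: (y =P v) => [->|_]; rewrite ?exv ?(negPf vS).
by case: ifP => _; rewrite ?cardsU1 // !inE (negPf vS).
Qed.

Lemma degree_sum_add_leaf :
  (\sum_(x in v |: S) deg (v |: S) x = \sum_(x in S) deg S x + 2)%N.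
Proof.
rewrite big_setU1 //= deg_leaf.
have -> : (\sum_(x in S) deg (v |: S) x = \sum_(x in S) (deg S x + (x == u)))%N.
  by apply: eq_bigr => x; apply: deg_add_leaf.
rewrite big_split /= addnC -addnA; congr (_ + _)%N.
rewrite (bigD1 u) //= eqxx big1 //.
by move=> i /andP[_ /negPf->].
Qed.

Lemma degree_sum2_add_leaf : degree_sum2 S <-> degree_sum2 (v |: S).
Proof.
by rewrite /degree_sum2 degree_sum_add_leaf cardsU1 vS; split; lia.
Qed.

End AddLeaf.

(** An isolated vertex would be all of [K] by connectedness, and the degree sum would be 0 instead
    of 2. *)
Lemma deg_gt0 K w : connected_on K -> degree_sum2 K -> w \in K -> (0 < deg K w)%N.
Proof.
move=> cK dK wK; rewrite lt0n; apply/negP => /eqP d0.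
have K1 : [set w] = K.
  apply: cK; rewrite ?sub1set //; first by apply/set0Pn; exists w; rewrite inE.
  move=> a b; rewrite inE => /eqP-> bK ewb.
  by move/eqP: d0; rewrite cards_eq0 => /eqP/setP/(_ b); rewrite !inE bK ewb.
by move: dK; rewrite /degree_sum2 -K1 big_set1 cards1 K1 d0.
Qed.

Lemma deg_cycle s x : (2 < size s)%N -> shaped e (cycle_rel (size s)) s ->
  x \in s -> deg [set y in s] x = 2%N.
Proof.
move=> s2 [us hs] xs; rewrite /deg.
pose i := index x s; have hi : (i < size s)%N by rewrite index_mem.
pose i1 := if i.+1 == size s then 0%N else i.+1.
pose i2 := if i == 0%N then (size s).-1 else i.-1.
have h1 : (i1 < size s)%N by rewrite /i1; case: (i.+1 =P _); lia.
have h2 : (i2 < size s)%N by rewrite /i2; case: (i =P 0%N); lia.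
have -> : [set y in [set y in s] | e x y] = [set nth x s i1; nth x s i2].
  apply/setP => y; rewrite !inE; apply/idP/idP.
    case/andP=> ys exy; have hj : (index y s < size s)%N by rewrite index_mem.
    have := hs x i (index y s) hi hj; rewrite !nth_index // exy cycle_relE //.
    by move/esym/orP=> [/eqP h|/eqP h]; rewrite -(nth_index x ys) h eqxx ?orbT.
  have hx j : (j < size s)%N -> cycle_rel (size s) i j -> e x (nth x s j).
    by move=> hj hij; rewrite -{1}(nth_index x xs) hs.
  by case/orP=> /eqP->; rewrite mem_nth //= hx // cycle_relE // eqxx ?orbT.
rewrite cards2 nth_uniq // /i1 /i2; case: (i.+1 =P _); case: (i =P 0%N); lia.
Qed.

Lemma connected_cycle s : (2 < size s)%N -> shaped e (cycle_rel (size s)) s ->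
  connected_on [set y in s].
Proof.
move=> s2 [us hs] A sA /set0Pn[a aA] cA.
have as_ : a \in s by have := subsetP sA a aA; rewrite inE.
have step m : nth a s ((index a s + m) %% size s) \in A.
  elim: m => [|m IH]; first by rewrite addn0 modn_small ?index_mem // nth_index.
  apply: (cA _ _ IH); first by rewrite inE mem_nth // ltn_mod; lia.
  rewrite hs ?ltn_mod; try lia.
  rewrite /cycle_rel.
  have -> : (((index a s + m) %% size s).+1 %% size s = (index a s + m.+1) %% size s)%N.
    by rewrite -addn1 modnDml addn1 addnS.
  by rewrite eqxx.
apply/eqP; rewrite eqEsubset sA /=; apply/subsetP => x; rewrite inE => xs.
have := step (size s - index a s + index x s)%N.
have hi : (index a s < size s)%N by rewrite index_mem.
rewrite addnA subnKC; last exact: ltnW.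
rewrite modnDl modn_small ?index_mem //.
by rewrite nth_index.
Qed.

Lemma unicyc_connected S : unicyc e S -> connected_on S.
Proof.
elim=> [s s2 hs|S' u v _ cS uS vS hv]; first exact: connected_cycle.
exact: (connected_on_add_leaf uS hv).
Qed.

Lemma unicyc_degree_sum S : unicyc e S -> degree_sum2 S.
Proof.
elim=> [s s2 hs|S' u v _ dS uS vS hv]; last exact/(degree_sum2_add_leaf uS vS hv).
rewrite /degree_sum2 (eq_bigr (fun=> 2%N)).
  by rewrite sum_nat_const mulnC.
by move=> x; rewrite inE; apply: deg_cycle.
Qed.

End Degrees.

(** * Lower bound: pendant paths and the edge move *)

Section PendantPaths.
Variables (T : finType) (e : rel T).
Hypotheses (e_sym : symmetric e) (e_irr : irreflexive e).
Implicit Types (S A K : {set T}) (p q : seq T).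

Lemma chain_nbr K w p v z : chain e K w p -> v \in p -> z \in K -> z != w ->
  e v z = false.
Proof.
elim: p K w => [//|u p IH] K w /= /and4P[uK wK /forall_inP hu hp].
rewrite inE => /orP[/eqP->|vp] zK zw; first by rewrite (eqP (hu z zK)) (negPf zw).
by apply: (IH _ _ hp vp); rewrite ?inE ?zK ?orbT //; apply: contraNneq uK => <-.
Qed.

Lemma eq_chain e' K w p : {in p, e =2 e'} -> chain e K w p = chain e' K w p.
Proof.
elim: p K w => [//|u p IH] K w h /=; rewrite IH; last first.
  by move=> x xp; apply: h; rewrite inE xp orbT.
by congr [&& _, _, _ & _]; apply: eq_forallb_in => y _; rewrite h // inE eqxx.
Qed.

Lemma chain_closed K w p A : chain e K w p ->
  (forall a b, a \in A -> e a b -> b \in A) -> (last w p \in A) = (w \in A).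
Proof.
move=> + cA; elim: p K w => [//|u p IH] K w /= /and4P[uK wK /forall_inP hu hp].
have euw : e u w by rewrite (eqP (hu w wK)) eqxx.
rewrite (IH _ _ hp); apply/idP/idP => h; first exact: cA euw.
by apply: cA h _; rewrite e_sym.
Qed.

Lemma leaf_nbr S w : deg e S w = 1%N ->
  exists2 u, u \in S & forall y, y \in S -> e w y = (y == u).
Proof.
move/eqP/cards1P => [u hu]; have hy y : (y \in S) && e w y = (y == u).
  by have := congr1 (fun B : {set T} => y \in B) hu; rewrite !inE.
have /andP[uS _] : (u \in S) && e w u by rewrite hy.
by exists u => // y yS; rewrite -hy yS.
Qed.

Lemma extend_pendant_path K w p : connected_on e K -> degree_sum2 e K ->
  w \in K -> chain e K w p ->
  exists K' w' p', [/\ chain e K' w' (p' ++ p), w' \in K', (1 < deg e K' w')%N,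
    K' :|: [set x in p' ++ p] = K :|: [set x in p] & last w' (p' ++ p) = last w p].
Proof.
elim: {K}#|K| {-2}K (erefl #|K|) w p => [|n IH] K cK w p coK dK wK hp.
  by move/eqP: cK; rewrite cards_eq0 => /eqP K0; rewrite K0 inE in wK.
have := deg_gt0 coK dK wK; rewrite leq_eqVlt => /orP[/eqP/esym d1|d2]; last first.
  by exists K, w, [::].
have [u uK hu] := leaf_nbr d1.
have uw : u != w by apply/negP => /eqP uw; have := hu u uK; rewrite uw e_irr eqxx.
have uK' : u \in K :\ w by rewrite !inE uw.
have wK' : w \notin K :\ w by rewrite !inE eqxx.
have hu' y : y \in K :\ w -> e w y = (y == u) by rewrite inE => /andP[_ /hu].
have [|||||K' [w' [p' [h1 h2 h3 h4 h5]]]] := IH (K :\ w) _ u (w :: p).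
- by move: cK; rewrite (cardsD1 w K) wK => -[].
- by apply: (connected_on_del_leaf e_sym wK' hu'); rewrite setD1K.
- by apply/(degree_sum2_add_leaf e_sym e_irr uK' wK' hu'); rewrite setD1K.
- by [].
- rewrite /= wK' uK' setD1K // hp andbT /=.
  by apply/forall_inP => y /hu'->.
exists K', w', (rcons p' w); rewrite cat_rcons; split=> //.
by rewrite h4 set_seq_cons setUA [_ :|: [set w]]setUC setD1K.
Qed.

Lemma pendant_path l : connected_on e setT -> degree_sum2 e setT ->
  deg e setT l = 1%N ->
  exists K w p, [/\ chain e K w p, p != [::], w \in K, (1 < deg e K w)%N &
    K :|: [set x in p] = setT /\ last w p = l].
Proof.
move=> cT dT d1; have [u _ hu] := leaf_nbr d1.
have ul : u != l by apply/negP => /eqP ul; have := hu u (in_setT _); rewrite ul e_irr eqxx.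
have uK : u \in [set~ l] by rewrite !inE.
have lK : l \notin [set~ l] by rewrite !inE eqxx.
have hu' y : y \in [set~ l] -> e l y = (y == u) by move=> _; rewrite hu.
have eT : l |: [set~ l] = setT by rewrite -(setD1K (in_setT l)) setTD.
have [||||K [w [p [h1 h2 h3 h4 h5]]]] := @extend_pendant_path [set~ l] u [:: l].
- by apply: (connected_on_del_leaf e_sym lK hu'); rewrite eT.
- by apply/(degree_sum2_add_leaf e_sym e_irr uK lK hu'); rewrite eT.
- by [].
- rewrite /= lK uK andbT /=; apply/forall_inP => y /hu'->; exact: eqxx.
exists K, w, (p ++ [:: l]); split=> //; first by case: (p).
split=> //; rewrite h4 -eT setUC; congr (_ :|: _).
by rewrite set_seq_cons set_seq_nil setU0.
Qed.

End PendantPaths.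

(* Replacing the edge [wz] by [lz], where [l] is the end of a path hanging from
   [w], turns that path into a subdivision of the edge [wz]. *)
Section MoveEdge.
Variables (T : finType) (e : rel T).
Hypotheses (e_sym : symmetric e) (e_irr : irreflexive e).
Variables (K : {set T}) (w : T) (p : seq T) (z : T).
Hypotheses (hp : chain e K w p) (pn : p != [::]) (KpT : K :|: [set x in p] = setT).
Hypotheses (wK : w \in K) (zK : z \in K) (ewz : e w z).
Local Notation l := (last w p).

Definition pair_rel (a b : T) : rel T :=
  fun x y => (x == a) && (y == b) || (x == b) && (y == a).
(** The common part of both graphs: [e] adds [zw] to it and [move_edge] adds [zl], so
    [ipoly_add_edge] reduces the comparison to two correction terms. *)
Definition cut_edge : rel T := fun x y => e x y && ~~ pair_rel z w x y.
Definition move_edge : rel T := fun x y => cut_edge x y || pair_rel z l x y.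

Lemma pair_rel_sym a b : symmetric (pair_rel a b).
Proof. by move=> x y; rewrite /pair_rel orbC (andbC (x == a)) (andbC (x == b)). Qed.

Lemma cut_edge_sym : symmetric cut_edge.
Proof. by move=> x y; rewrite /cut_edge e_sym pair_rel_sym. Qed.

Lemma cut_edge_irr : irreflexive cut_edge.
Proof. by move=> x; rewrite /cut_edge e_irr. Qed.

Lemma move_edge_sym : symmetric move_edge.
Proof. by move=> x y; rewrite /move_edge cut_edge_sym pair_rel_sym. Qed.

Let zw : z != w. Proof. by apply: contraTneq ewz => ->; rewrite e_irr. Qed.
Let notin_K v : v \in p -> v \notin K.
Proof.
by have [_ /disjointFr h] := chain_uniq hp => vp; rewrite h // inE.
Qed.
Let lp : l \in p.
Proof. by case: (p) pn => //= v q _; apply: mem_last. Qed.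
Let lz : l != z. Proof. by apply: contraTneq zK => <-; apply: notin_K. Qed.
Let lw : l != w. Proof. by apply: contraTneq wK => <-; apply: notin_K. Qed.
Let elz : e l z = false. Proof. exact: (chain_nbr hp lp zK zw). Qed.

Lemma move_edge_irr : irreflexive move_edge.
Proof.
move=> x; rewrite /move_edge cut_edge_irr /pair_rel /=.
by case: (x =P z) => [->|_]; rewrite ?andbF // eq_sym (negPf lz).
Qed.

Lemma cut_edge_chain : {in p, e =2 cut_edge}.
Proof.
move=> v vp y; rewrite /cut_edge /pair_rel.
have := notin_K vp; case: (v =P z) => [->|_]; first by rewrite zK.
by case: (v =P w) => [->|_]; rewrite ?wK // andbT.
Qed.

(** In the new graph [w] still reaches [l] along the path and [l] is joined to [z], so a closed set
    contains both ends of the lost edge or neither. *)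
Lemma move_edge_connected : connected_on e setT -> connected_on move_edge setT.
Proof.
move=> ce A sA A0 cA; apply: ce => // a b aA _ eab.
have cA' x y : x \in A -> move_edge x y -> y \in A by move=> xA; apply: cA; rewrite ?inE.
have lwA : (l \in A) = (w \in A).
  apply: (chain_closed cut_edge_sym (K := K)).
    by rewrite -(eq_chain _ _ cut_edge_chain).
  by move=> x y xA exy; apply: (cA' x) => //; rewrite /move_edge exy.
have lzA : (l \in A) = (z \in A).
  have mlz : move_edge l z by rewrite /move_edge /pair_rel !eqxx /= !orbT.
  by apply/idP/idP => h; apply: cA' h _ => //; rewrite move_edge_sym.
case: (boolP (pair_rel z w a b)) => [|nab]; last first.
  by apply: (cA' a) => //; rewrite /move_edge /cut_edge eab nab.
by case/orP=> /andP[/eqP ea /eqP ->]; move: aA; rewrite ea -?lwA -?lzA ?lwA ?lzA.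
Qed.

(** At [z] loss and gain cancel. Both sides are sums in order to avoid subtraction of natural
    numbers. *)
Lemma deg_move_edge x : (deg move_edge setT x + (x == w) = deg e setT x + (x == l))%N.
Proof.
have degE (r : rel T) : deg r setT x = (\sum_y (r x y : nat))%N.
  rewrite /deg -sum1_card [RHS](bigID (fun y => r x y)) /= [X in (_ + X)%N]big1 ?addn0.
    by apply: eq_big => y; rewrite !inE //= => ->.
  by move=> y /negPf->.
have pairE a b : a != b ->
    (\sum_y (pair_rel a b x y : nat) = (x == a) + (x == b))%N.
  move=> ab; rewrite (bigD1 a) //= (bigD1 b) ?[b == a]eq_sym //= big1.
    rewrite /pair_rel !eqxx !andbT [b == a]eq_sym (negPf ab) !andbF orbF orFb addn0.
    by rewrite addnC.
  by move=> y /andP[/negPf ya /negPf yb]; rewrite /pair_rel ya yb !andbF.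
have main : (deg move_edge setT x + ((x == z) + (x == w)) =
             deg e setT x + ((x == z) + (x == l)))%N.
  rewrite -!pairE // 1?eq_sym // !degE -!big_split /=; apply: eq_bigr => y _.
  rewrite /move_edge /cut_edge.
  have h1 : pair_rel z w x y -> e x y.
    by case/orP=> /andP[/eqP-> /eqP->] //; rewrite e_sym.
  have h2 : pair_rel z l x y -> ~~ e x y.
    by case/orP=> /andP[/eqP-> /eqP->]; rewrite ?elz // e_sym elz.
  by move: h1 h2; do 3 case: (_ x y) => //=; move=> h1 h2; try (by have := h1 isT);
     try (by have := h2 isT).
by move: main; lia.
Qed.

Lemma move_edge_degree_sum : degree_sum2 e setT -> degree_sum2 move_edge setT.
Proof.
rewrite /degree_sum2 => <-.
have : (\sum_(x in [set: T]) (deg move_edge setT x + (x == w)) =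
        \sum_(x in [set: T]) (deg e setT x + (x == l)))%N.
  by apply: eq_bigr => x _; apply: deg_move_edge.
have one a : (\sum_(x in [set: T]) (x == a) = 1)%N.
  by rewrite (bigD1 a) ?inE //= eqxx big1 // => x /andP[_ /negPf->].
by rewrite !big_split /= !one; lia.
Qed.

(** [l] acquires a second neighbour, and [w] does not become a leaf, as it had at least two
    neighbours in [K] and one on the path. *)
Lemma move_edge_leaves : deg e setT l = 1%N -> (1 < deg e K w)%N ->
  (#|[set x | deg move_edge setT x == 1%N]| < #|[set x | deg e setT x == 1%N]|)%N.
Proof.
move=> dl dw; apply: proper_card; apply/properP; split; last first.
  exists l; rewrite !inE ?dl //.
  by have := deg_move_edge l; rewrite eqxx (negPf lw) dl; lia.
apply/subsetP => x; rewrite !inE => /eqP dx; have := deg_move_edge x; rewrite dx.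
case: (x =P l) => [->|_]; first by rewrite (negPf lw) dl.
case: (x =P w) => [->|_]; last by rewrite !addn0 => <-.
have : (2 < deg e setT w)%N; last by lia.
have [v vp ewv] : exists2 v, v \in p & e w v.
  case: (p) hp pn => //= v q /and4P[_ _ /forall_inP/(_ w wK)/eqP h _] _.
  by exists v; rewrite ?mem_head // e_sym h eqxx.
have vD : v \notin [set y in K | e w y] by rewrite inE (negPf (notin_K vp)).
rewrite /deg in dw *; apply: (@leq_trans #|v |: [set y in K | e w y]|).
  by rewrite cardsU1 vD.
apply: subset_leq_card; apply/subsetP => y; rewrite !inE.
by case/orP=> [/eqP->|/andP[]].
Qed.

Variable R : rcfType.
Local Notation I := (ipoly R cut_edge).
Local Notation K1 := (K :\: cnbhd cut_edge z).
Local Notation P := (path_poly R).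

Let hc : chain cut_edge K w p.
Proof. by rewrite -(eq_chain _ _ cut_edge_chain). Qed.

Let K1_sub : K1 \subset K. Proof. exact: subsetDl. Qed.

Let p_K v : v \in p -> v \in K = false.
Proof. by move/notin_K/negPf. Qed.

Let wK1 : w \in K1.
Proof.
rewrite !inE wK andbT negb_or eq_sym zw /=.
by rewrite /cut_edge /pair_rel !eqxx andbF.
Qed.

Let setT_cnbhd_z : setT :\: cnbhd cut_edge z = K1 :|: [set x in p].
Proof.
apply/setP => x; rewrite !inE andbT.
have : x \in K :|: [set x in p] by rewrite KpT inE.
rewrite !inE; case: (boolP (x \in p)) => xp; last by rewrite orbF => ->; rewrite andbT orbF.
rewrite p_K // => _; rewrite andbF /= negb_or.
rewrite (contraTneq _ zK) => [|<-]; last exact: notin_K.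
by rewrite cut_edge_sym (chain_nbr hc).
Qed.

(** [N[w]] takes the first vertex of the path, and the other [size p - 1] form a separate
    component. *)
Let minus_w : I (setT :\: cnbhd cut_edge z :\: cnbhd cut_edge w) =
  P (size p) * I (K1 :\: cnbhd cut_edge w).
Proof.
rewrite setT_cnbhd_z.
have := hc; case: p pn p_K => // v q _ pK /= /and4P[vK _ /forall_inP hv hq].
have -> : (K1 :|: [set x in v :: q]) :\: cnbhd cut_edge w =
    K1 :\: cnbhd cut_edge w :|: [set x in q].
  apply/setP => x; rewrite !inE.
  case: (x =P v) => [->|_] /=.
    rewrite cut_edge_sym (eqP (hv w wK)) eqxx (negPf vK) orbT !andbF /=.
    have [_ /disjointFl h] := chain_uniq hq.
    by have := h v; rewrite !inE eqxx => ->.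
  case: (boolP (x \in q)) => xq; rewrite ?orbF // !orbT andbT.
  rewrite cut_edge_sym (chain_nbr hq xq) ?inE ?wK ?orbT //; last first.
    by apply: contraTneq wK => ->.
  by rewrite orbF; apply: contraTneq wK => <-; rewrite pK // inE xq orbT.
have s1 : K1 :\: cnbhd cut_edge w \subset v |: K.
  by rewrite (subset_trans (subsetDl _ _)) // (subset_trans K1_sub) ?subsetUr.
rewrite (ipoly_chain R cut_edge_sym cut_edge_irr hq s1).
by rewrite ifF // !inE (negPf vK) !andbF.
Qed.

(** [N[l]] takes the last two vertices of the path, and the rest still hangs from [w]. If the path
    is [l] alone, its neighbour is [w] itself, hence the separate case. *)
Let minus_l : I (setT :\: cnbhd cut_edge z :\: cnbhd cut_edge l) =
  P (size p).-1 * I (K1 :\ w) +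
  (if (size p < 2)%N then 0 else 'X * P (size p).-2 * I (K1 :\: cnbhd cut_edge w)).
Proof.
rewrite setT_cnbhd_z.
have := hc; case: (lastP p) pn p_K => // p' v _ pK.
rewrite last_rcons size_rcons /= -cats1 chain_cat /= => /andP[hp' /and4P[vK _ /forall_inP hv _]].
case: (lastP p') hp' vK hv pK => [|p'' m] hp' vK hv pK /=.
  rewrite mul1r addr0; congr (ipoly _ _ _); apply/setP => x; rewrite !inE.
  have vK' : v \notin K by move: vK; rewrite !inE negb_or => /andP[].
  case: (x =P v) => [->|_] /=; first by rewrite (negPf vK') !andbF.
  case: (boolP (x \in K)) => xK; rewrite ?andbF // !orbF !andbT.
  by rewrite (eqP (hv x _)) // !inE xK.
rewrite size_rcons !ltnS /=; rewrite last_rcons in hv.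
have hp'' := hp'; rewrite -cats1 chain_cat in hp''; case/andP: hp'' => hp'' hm.
have -> : (K1 :|: [set x in rcons p'' m ++ [:: v]]) :\: cnbhd cut_edge v =
   K1 :|: [set x in p''].
  have [] := chain_uniq hp'; rewrite rcons_uniq => /andP[mp _] _.
  have mK : m \in K = false by apply: pK; rewrite !mem_rcons !inE mem_rcons inE eqxx orbT.
  apply/setP => x; rewrite !inE mem_cat mem_rcons !inE.
  case: (x =P v) => [->|_] /=.
    move: vK; rewrite !inE mem_rcons inE !negb_or => /and3P[/negPf-> _ /negPf->].
    by rewrite andbF.
  case: (x =P m) => [->|/eqP xm] /=.
    rewrite mK (negPf mp) !andbF (eqP (hv m _)) ?eqxx //.
    by rewrite !inE mem_rcons inE eqxx orbT.
  rewrite orbF; have [xKp|] := boolP ((x \in K) || (x \in p'')).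
    by rewrite (eqP (hv x _)) ?(negPf xm) // !inE mem_rcons inE (negPf xm).
  by case/norP=> /negPf-> /negPf->; rewrite !andbF.
by rewrite (ipoly_chain R cut_edge_sym cut_edge_irr hp'' K1_sub) wK1.
Qed.

(** With [a = I(K1 - w)], [b = I(K1 - N[w])] and [s = size p], the recursion for [P s] turns the
    difference of the correction terms into [y^2 P(s-1) (b - a)], and [a <= b] by antitonicity. *)
Lemma ipoly_move_edge x y : pos_on x (ipoly R e setT) -> x < y <= 0 ->
  (ipoly R e setT).[y] <= (ipoly R move_edge setT).[y].
Proof.
move=> hpos hy.
have he : ipoly R e setT =
    I setT - 'X^2 * I (setT :\: cnbhd cut_edge z :\: cnbhd cut_edge w).
  apply: ipoly_add_edge; rewrite ?inE //; try exact: cut_edge_sym.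
  - exact: cut_edge_irr.
  - by rewrite /cut_edge /pair_rel !eqxx andbF.
  move=> a b; rewrite /cut_edge -/(pair_rel z w a b).
  case: (boolP (pair_rel z w a b)) => h; rewrite ?andbT ?orbF // orbT.
  by case/orP: h => /andP[/eqP-> /eqP->] //; rewrite e_sym.
have hm : ipoly R move_edge setT =
    I setT - 'X^2 * I (setT :\: cnbhd cut_edge z :\: cnbhd cut_edge l).
  apply: ipoly_add_edge; rewrite ?inE //; try exact: cut_edge_sym.
  - exact: cut_edge_irr.
  - by rewrite eq_sym.
  - by rewrite /cut_edge e_sym elz.
(* Away from [z] nothing was cut, so positivity for [e] applies to the subsets of [K1]. *)
have Ie (S : {set T}) : z \notin S -> I S = ipoly R e S.
  move=> zS; apply: eq_ipoly => a b aS bS; rewrite /cut_edge /pair_rel.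
  have /negPf-> : a != z by apply: contraNneq zS => <-.
  have /negPf-> : b != z by apply: contraNneq zS => <-.
  by rewrite !andbF andbT.
have zK1 (S : {set T}) : S \subset K1 -> z \notin S.
  by move=> sS; apply/negP => /(subsetP sS); rewrite !inE eqxx.
have hk : (I (K1 :\ w)).[y] <= (I (K1 :\: cnbhd cut_edge w)).[y].
  rewrite !Ie; try by apply: zK1; rewrite ?subsetDl ?subD1set.
  apply: (ipoly_antimono e_sym e_irr _ _ hy).
    by apply: setDS; rewrite sub1set !inE eqxx.
  exact: (pos_on_sub e_sym e_irr (subsetT _) hpos).
(* The polynomial of the path without its last two vertices, an induced subgraph; for a shorter [p]
   it is 1. *)
have hP : 0 <= (P (size p).-1).[y].
  case: (lastP p) hp => [|p' v]; first by rewrite /= hornerC ler01.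
  rewrite -cats1 chain_cat => /andP[hp' _]; rewrite size_cat addn1 /=.
  case: (lastP p') hp' => [|p'' m]; first by rewrite /= hornerC ler01.
  rewrite -cats1 chain_cat => /andP[hp'' _]; rewrite size_cat addn1 /=.
  rewrite -(ipoly_chain0 R e_sym e_irr hp'') ltW //.
  exact: (pos_on_sub e_sym e_irr (subsetT _) hpos).
rewrite he hm minus_w minus_l.
set a := I (K1 :\ w) in hk *; set b := I (K1 :\: _) in hk *.
rewrite !(hornerD, hornerN, hornerM, hornerXn) lerD2l lerN2 ler_wpM2l ?sqr_ge0 //.
case: (ltnP (size p) 2) => sp.
  have -> : size p = 1%N by case: (p) pn sp => // ? [].
  by rewrite /= !hornerC !mul1r addr0.
move: hP; case: (size p) sp => [|[|s]] //= _ hP.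
rewrite path_polySS !(hornerD, hornerM, hornerX).
by have := ler_wpM2l hP hk; lra.
Qed.

End MoveEdge.

(** * Lower bound: reduction to the cycle *)

Section LowerBound.
Variables (R : rcfType) (T : finType).
Implicit Types (e : rel T) (x y : R).

(* A simple path that cannot be extended closes up, as every other return edge
   would create a vertex of degree 3. *)
Lemma two_regular_cycle e : symmetric e -> irreflexive e -> connected_on e setT ->
  (0 < #|T|)%N -> (forall v, deg e setT v = 2%N) ->
  exists s : seq T, [/\ (2 < size s)%N, shaped e (cycle_rel (size s)) s &
    [set x in s] = setT].
Proof.
move=> es ei cT T0 d2.
have nb3 v a b c : e v a -> e v b -> e v c -> a != b -> a != c -> b != c -> False.
  move=> va vb vc ab ac bc; have := d2 v; rewrite /deg => h.
  have : (#|[set a; b; c]| <= #|[set y in setT | e v y]|)%N.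
    apply: subset_leq_card; apply/subsetP => z; rewrite !inE /=.
    by case/orP=> [/orP[]|] /eqP->.
  by rewrite h setUC cardsU1 cards2 ab !inE ![c == _]eq_sym (negPf ac) (negPf bc).
have grow n a p : (#|T| - size p <= n)%N -> path e a p -> uniq (a :: p) -> p != [::] ->
    exists s : seq T, [/\ (2 < size s)%N, uniq s &
      forall (x0 : T) i j, (i < size s)%N -> (j < size s)%N -> cycle_rel (size s) i j ->
        e (nth x0 s i) (nth x0 s j)].
  elim: n a p => [|n IH] a p cp pp up pn.
    have := max_card (mem (a :: p)); rewrite (card_uniqP up) /=.
    by move: cp; rewrite leqn0 subn_eq0 => cp h; have := leq_trans h cp; rewrite ltnn.
  have consec i : (i < size p)%N -> e (nth a (a :: p) i) (nth a (a :: p) i.+1).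
    by move=> hi; have /pathP := pp; apply.
  have N1 : (0 < size p)%N by rewrite lt0n size_eq0.
  pose z1 := nth a (a :: p) (size p).-1; pose z0 := nth a (a :: p) (size p).
  have ez1 : e z0 z1.
    by rewrite es; have := consec (size p).-1; rewrite prednK // => -> //; lia.
  have [z ezz zz1] : exists2 z, e z0 z & z != z1.
    have := d2 z0; rewrite /deg (cardsD1 z1) !inE ez1 /= add1n => -[] /eqP/cards1P[z hz].
    by have := set11 z; rewrite -hz !inE => /andP[h1 h2]; exists z.
  have [zs|zs] := boolP (z \in a :: p); last first.
    apply: (IH a (rcons p z)); first by rewrite size_rcons; lia.
    - by rewrite rcons_path pp /=; move: ezz; rewrite /z0 nth_last.
    - by rewrite -rcons_cons rcons_uniq zs.
    - by case: (p).
  have hj : (index z (a :: p) < (size p).+1)%N by have := zs; rewrite -index_mem.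
  have zE := nth_index a zs; move: (index z _) hj zE => j hj zE.
  have jN : j != size p by apply: contraTneq ezz => jN; rewrite -zE jN ei.
  have jN1 : j != (size p).-1 by apply: contraNneq zz1 => jN1; rewrite -zE jN1.
  have [j0|j0] := posnP j; last first.
    exfalso; apply: (nb3 z (nth a (a :: p) j.-1) (nth a (a :: p) j.+1) z0).
    - by rewrite es -zE; have := consec j.-1; rewrite prednK //; apply; lia.
    - by rewrite -zE; apply: consec; lia.
    - by rewrite es.
    - by rewrite nth_uniq //=; lia.
    - by rewrite nth_uniq //=; lia.
    - by rewrite nth_uniq //=; lia.
  exists (a :: p); split=> //=; first by lia.
  move=> x0 i k hi hk; rewrite !(set_nth_default a x0) //.
  have za : z = a by rewrite -zE j0.
  rewrite cycle_relE //; last by lia.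
  case/orP=> /eqP->.
    case: (i.+1 =P (size p).+1) => [[->]|/eqP iN]; first by rewrite -/z0 -[nth a _ 0]za.
    by apply: consec; lia.
  rewrite es; case: (i =P 0%N) => [->|/eqP i0] /=; first by rewrite -/z0 -[X in e _ X]za.
  by have := consec i.-1; rewrite prednK ?lt0n //; apply; lia.
have [a _] : exists a, a \in T by apply/card_gt0P.
have [b eab] : exists b, e a b.
  have : [set y in setT | e a y] != set0 by rewrite -card_gt0 -/(deg e setT a) d2.
  by case/set0Pn=> b; rewrite !inE => eab; exists b.
have [||||s [s2 us hs]] := grow #|T| a [:: b].
- by rewrite leq_subr.
- by rewrite /= eab.
- by rewrite /= inE andbT; apply: contraTneq eab => ->; rewrite ei.
- by [].
(* The two cyclic neighbours exhaust the degree of a vertex of [s]. Hence [s] has no chord and is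
   closed under adjacency, so by connectedness it is everything. *)
have only (x0 : T) i c : (i < size s)%N -> e (nth x0 s i) c ->
    exists2 k, (k < size s)%N && cycle_rel (size s) i k & c = nth x0 s k.
  move=> hi eic.
  pose i1 := if i.+1 == size s then 0%N else i.+1.
  pose i2 := if i == 0%N then (size s).-1 else i.-1.
  have h1 : (i1 < size s)%N by rewrite /i1; case: (i.+1 =P _); lia.
  have h2 : (i2 < size s)%N by rewrite /i2; case: (i =P 0%N); lia.
  have c1 : cycle_rel (size s) i i1 by rewrite cycle_relE // eqxx.
  have c2 : cycle_rel (size s) i i2 by rewrite cycle_relE // eqxx orbT.
  have [->|n1] := eqVneq c (nth x0 s i1); first by exists i1; rewrite ?h1.
  have [->|n2] := eqVneq c (nth x0 s i2); first by exists i2; rewrite ?h2.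
  exfalso; apply: (nb3 (nth x0 s i) (nth x0 s i1) (nth x0 s i2) c) => //.
  - exact: hs.
  - exact: hs.
  - by rewrite nth_uniq // /i1 /i2; case: (i.+1 =P _); case: (i =P 0%N); lia.
  - by rewrite eq_sym.
  - by rewrite eq_sym.
exists s; split=> //.
  split=> // x0 i j hi hj; apply/idP/idP => [eij|]; last exact: hs.
  have [k /andP[hk cik] /eqP] := only x0 i _ hi eij.
  by rewrite nth_uniq // => /eqP->.
apply: cT; rewrite ?subsetT //.
  by apply/set0Pn; exists (nth a s 0%N); rewrite inE mem_nth // ltnW // ltnW.
move=> c d; rewrite !inE => cs _ ecd.
have := only c (index c s) d; rewrite index_mem nth_index // => /(_ cs ecd).
by case=> k /andP[hk _] ->; rewrite mem_nth.
Qed.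

Lemma ipoly_le_lucas e x y : symmetric e -> irreflexive e ->
  connected_on e setT -> degree_sum2 e setT -> (0 < #|T|)%N ->
  pos_on x (ipoly R e setT) -> x < y <= 0 ->
  (ipoly R e setT).[y] <= (lucas_poly R #|T|).[y].
Proof.
elim/(@ltn_ind): {e}#|[set v | deg e setT v == 1%N]| {-2}e (erefl #|[set v | deg e setT v == 1%N]|)
  => n IH e ce es ei cT dT T0 hpos hy.
have [l0|[l]] := set_0Vmem [set v | deg e setT v == 1%N].
  (* Without leaves all degrees are at least 2, and their mean is 2. *)
  have d2 v : (1 < deg e setT v)%N.
    rewrite ltn_neqAle eq_sym deg_gt0 ?inE // andbT.
    by move/setP/(_ v): l0; rewrite !inE => ->.
  have d2' v : deg e setT v = 2%N.
    apply/eqP; rewrite eqn_leq d2 andbT leqNgt; apply/negP => dv.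
    move: dT; rewrite /degree_sum2 mulnC -sum_nat_const; apply/eqP.
    rewrite gtn_eqF // (bigD1 v) ?inE //= [X in (_ < X)%N](bigD1 v) ?inE //=.
    by rewrite -addSn leq_add // leq_sum.
  have [s [s2 hs sT]] := two_regular_cycle es ei cT T0 d2'.
  have [us _] := hs.
  by rewrite -sT (ipoly_cycle R es ei s2 hs) -cardsT -sT cardsE (card_uniqP us).
rewrite inE => /eqP dl.
have [K [w [p [hp pn wK dw [KpT lE]]]]] := pendant_path es ei cT dT dl.
have [z] : exists z, z \in [set y in K | e w y] by apply/set0Pn; rewrite -card_gt0 ltnW.
rewrite inE => /andP[zK ewz].
pose e' := move_edge e w p z.
have le := @ipoly_move_edge _ _ es ei _ _ _ _ hp pn KpT wK zK ewz R x.
(* The polynomial only grows, so the same interval serves for the new graph. *)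
have hpos' : pos_on x (ipoly R e' setT).
  by move=> t ht; apply: lt_le_trans (hpos t ht) (le t hpos ht).
apply: le_trans (le y hpos hy) _.
rewrite -lE in dl.
have := move_edge_leaves es ei hp pn wK zK ewz dl dw; rewrite ce => lt.
apply: (IH _ lt e' erefl) => //.
- exact: move_edge_sym.
- exact: (move_edge_irr ei hp pn zK).
- exact: (move_edge_connected es hp wK zK).
- exact: (move_edge_degree_sum es ei hp pn wK zK ewz).
Qed.

End LowerBound.

(** * Coefficients up to x^3 *)

Section ThirdCoefficient.
Variables (R : rcfType) (T : finType) (e : rel T).
Hypotheses (e_sym : symmetric e) (e_irr : irreflexive e).
Implicit Types (S : {set T}) (s : seq T).
Local Notation I S := (ipoly R e S).
Local Notation L := (lucas_poly R).

Lemma coef_addXM (p q : {poly R}) i : (p + 'X * q)`_i.+1 = p`_i.+1 + q`_i.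
Proof. by rewrite coefD coefXM. Qed.

Lemma lucas_small_coef i : (L 0)`_i.+1 = 0 /\ (L 1)`_i.+1 = 0.
Proof. by rewrite /lucas_poly /= coefMn !coef1 mul0rn. Qed.

Lemma lucas3_coef : (L 3)`_2 = 0 /\ (L 3)`_3 = 0.
Proof.
by split; rewrite (lucas_polySS _ 1%N) coef_addXM (lucas_polySS _ 0%N) !coef_addXM
  !(proj1 (lucas_small_coef _)) !(proj2 (lucas_small_coef _)) !addr0.
Qed.

Lemma lucas_coef0 n : (L n.+1)`_0 = 1.
Proof.
suff : (L n.+1)`_0 = 1 /\ (L n.+2)`_0 = 1 by case.
elim: n => [|n [IH1 IH2]].
  by rewrite lucas_polySS coefD coefXM /= addr0 /lucas_poly /= coef1.
by split=> //; rewrite lucas_polySS coefD coefXM addr0.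
Qed.

Lemma lucas_coef1 n : (L n.+2)`_1 = n.+2%:R.
Proof.
elim: n => [|n IH].
  by rewrite lucas_polySS coef_addXM /lucas_poly /= coefMn !coef1 add0r.
by rewrite lucas_polySS coef_addXM IH lucas_coef0 natr1.
Qed.

Lemma lucas_coef2 n : (L n.+4)`_2 = (L n.+3)`_2 + n.+2%:R.
Proof. by rewrite lucas_polySS coef_addXM lucas_coef1. Qed.

(** The shape of [unicyc_leaf_coef3] with degree 1: in the cubic coefficient, lengthening the cycle
    counts like a leaf at a vertex of degree 1. For [n = 3] degree 2 would be required instead, and
    this exception produces [D_n]. *)
Lemma lucas_coef3 n : (3 < n)%N -> (L n.+1)`_3 = (L n)`_3 + (L n)`_2 - n%:R + 2.
Proof.
case: n => [|[|[|[|n]]]] // _.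
by rewrite (lucas_polySS _ n.+3) coef_addXM lucas_coef2; ring.
Qed.

(** The shape of [unicyc_leaf_coef3] with the largest possible degree [|S| - 1], that of the
    centre. *)
Lemma star_coef3 m : (star_poly R m.+1)`_3 = (star_poly R m)`_3 + (L m.+3)`_2.
Proof.
rewrite star_polyS coef_addXM; congr (_ + _).
have h0 k : (edge_poly R k)`_0 = 1.
  elim: k => [|k IH]; first by rewrite /edge_poly mulr1 coefD coef1 coefZ coefX mulr0 addr0.
  by rewrite edge_polyS mulrDl mul1r coefD coefXM IH addr0.
have h1 k : (edge_poly R k)`_1 = k.+2%:R.
  elim: k => [|k IH]; first by rewrite /edge_poly mulr1 coefD coef1 coefZ coefX mulr1 add0r.
  by rewrite edge_polyS mulrDl mul1r coef_addXM IH h0 natr1.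
elim: m => [|m IH]; last by rewrite lucas_coef2 edge_polyS mulrDl mul1r coef_addXM IH h1.
rewrite /edge_poly mulr1 coefD coef1 coefZ coefX mulr0 addr0.
by rewrite (proj1 lucas3_coef).
Qed.

Lemma ipoly_coef0 S : (I S)`_0 = 1.
Proof. by rewrite -horner_coef0 ipoly_at0. Qed.

Lemma ipoly_coef1 S : (I S)`_1 = #|S|%:R.
Proof.
elim: {S}#|S| {-2}S (erefl #|S|) => [|n IH] S cS.
  by move/eqP: cS; rewrite cards_eq0 => /eqP->; rewrite ipoly0 coef1 cards0.
have [v vS] : exists v, v \in S by apply/card_gt0P; rewrite cS.
rewrite (ipolyD1 _ e_sym e_irr vS) coef_addXM ipoly_coef0 IH.
  by rewrite (cardsD1 v S) vS add1n natr1.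
by move: cS; rewrite (cardsD1 v S) vS => -[].
Qed.

Lemma card_cnbhd S u : u \in S -> (#|S :\: cnbhd e u| + (deg e S u).+1 = #|S|)%N.
Proof.
move=> uS; rewrite -(cardsID (cnbhd e u) S) addnC; congr (_ + _)%N.
have -> : S :&: cnbhd e u = u |: [set y in S | e u y].
  apply/setP => y; rewrite !inE; case: (y =P u) => [->|_] /=; first by rewrite uS.
  by [].
by rewrite cardsU1 !inE e_irr andbF add1n.
Qed.

(** Deleting [u] loses the nonadjacent pairs at [u], of which there are [|S| - 1 - deg u]. *)
Lemma ipoly_coef2_del S u : u \in S ->
  (I (S :\ u))`_2 = (I S)`_2 - #|S|%:R + 1 + (deg e S u)%:R.
Proof.
move=> uS; rewrite (ipolyD1 _ e_sym e_irr uS) coef_addXM ipoly_coef1.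
have := congr1 (fun n => n%:R : R) (card_cnbhd uS); rewrite natrD -natr1 => <-.
by ring.
Qed.

(** The coefficient counts nonadjacent pairs, and their number depends only on the numbers of
    vertices and edges. *)
Lemma unicyc_coef2 S : unicyc e S -> (I S)`_2 = (L #|S|)`_2.
Proof.
elim=> [s s2 hs|S' u v uS' IH uS vS hv].
  by rewrite (ipoly_cycle R e_sym e_irr s2 hs) cardsE (card_uniqP (proj1 hs)).
rewrite (ipolyU1_leaf R e_sym e_irr uS vS hv) coef_addXM ipoly_coef1 IH cardsU1 vS add1n.
have := unicyc_card uS'; rewrite (cardsD1 u S') uS add1n.
by case: #|_| => [|[|k]] // _; rewrite lucas_coef2.
Qed.

Lemma unicyc_leaf_coef3 S u v : unicyc e S -> u \in S -> v \notin S ->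
  (forall y, y \in S -> e v y = (y == u)) ->
  (I (v |: S))`_3 = (I S)`_3 + (L #|S|)`_2 - #|S|%:R + 1 + (deg e S u)%:R.
Proof.
move=> uS' uS vS hv.
rewrite (ipolyU1_leaf R e_sym e_irr uS vS hv) coef_addXM ipoly_coef2_del //.
by rewrite unicyc_coef2 //; ring.
Qed.

End ThirdCoefficient.

(** * Equality in the cubic coefficient: [D_n] and [U_n] *)

Section Extremal.
Variables (R : rcfType) (T : finType) (e : rel T).
Hypotheses (e_sym : symmetric e) (e_irr : irreflexive e).
Implicit Types (S : {set T}) (s : seq T).
Local Notation I S := (ipoly R e S).
Local Notation L := (lucas_poly R).

(** Mirrors [sym_adj] on positions, so that [D_rel] and [U_rel] agree with the given graphs by
    computation. *)
Definition sym_nat (r : rel nat) : rel nat :=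
  fun i j => (i != j) && (r i j || r j i).

Definition D_rel : rel nat :=
  sym_nat (fun i j => (j == i.+1) || (i == 0%N) && (j == 2%N)).
Definition U_rel : rel nat :=
  sym_nat (fun i j => (i == 0%N) || (i == 1%N) && (j == 2%N)).

Lemma sym_natC r i j : sym_nat r i j = sym_nat r j i.
Proof. by rewrite /sym_nat eq_sym orbC. Qed.

Lemma shaped_rcons r s k v : shaped e (sym_nat r) s -> (k < size s)%N -> v \notin s ->
  (forall y, y \in s -> e v y = (y == nth v s k)) ->
  (forall i, (i < size s)%N -> sym_nat r (size s) i = (i == k)) ->
  shaped e (sym_nat r) (rcons s v).
Proof.
move=> [us hs] ks vs hv hr; split; first by rewrite rcons_uniq vs us.
have new x0 i : (i < size s)%N -> e v (nth x0 s i) = sym_nat r (size s) i.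
  move=> hi; rewrite hr // hv ?mem_nth // (set_nth_default x0 v ks).
  by rewrite nth_uniq.
move=> x0 i j; rewrite size_rcons !ltnS !nth_rcons => hi hj.
case: (ltngtP i (size s)) hi => // [hi|->] _; case: (ltngtP j (size s)) hj => // [hj|->] _.
- exact: hs.
- by rewrite e_sym new // sym_natC.
- exact: new.
- by rewrite e_irr /sym_nat eqxx.
Qed.

(** In a triangle the order of the vertices is free, so the vertex receiving the leaf can be put
    where the labelling wants it: last for [D_rel], first for [U_rel]. *)
Lemma shaped_triangle r s t : shaped e (cycle_rel (size s)) s -> size s = 3%N ->
  perm_eq s t -> (forall i j, (i < 3)%N -> (j < 3)%N -> r i j = (i != j)) ->
  shaped e r t.
Proof.
move=> [us hs] s3 st hr.
have complete x y : x \in s -> y \in s -> e x y = (x != y).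
  move=> xs ys; have ix : (index x s < size s)%N by rewrite index_mem.
  have iy : (index y s < size s)%N by rewrite index_mem.
  have := hs x _ _ ix iy; rewrite !nth_index // => ->.
  have -> : (x == y) = (index x s == index y s).
    by apply/eqP/eqP => [->//|h]; rewrite -(nth_index x xs) h nth_index.
  by move: ix iy; rewrite s3; move: (index x s) (index y s) => [|[|[|i]]] // [|[|[|j]]].
split; first by rewrite -(perm_uniq st).
move=> x0 i j; rewrite -(perm_size st) s3 => hi hj.
rewrite complete ?(perm_mem st) ?mem_nth // -?(perm_size st) ?s3 //.
by rewrite nth_uniq -?(perm_uniq st) -?(perm_size st) ?s3 // hr.
Qed.

Lemma deg_gt1 S u a b : a \in S -> b \in S -> e u a -> e u b -> a != b ->
  (1 < deg e S u)%N.
Proof.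
move=> aS bS ua ub ab; have : (#|[set a; b]| <= deg e S u)%N.
  by apply: subset_leq_card; apply/subsetP => z; rewrite !inE => /orP[]/eqP->;
    rewrite ?aS ?bS.
by rewrite cards2 ab.
Qed.

Lemma card_set_seq s : uniq s -> #|[set x in s]| = size s.
Proof. by move=> us; rewrite cardsE; apply/card_uniqP. Qed.

Lemma perm_rem u s : u \in s -> perm_eq s (rcons (rem u s) u).
Proof. by move=> us; rewrite perm_sym perm_rcons perm_sym perm_to_rem. Qed.

(** Relative to a longer cycle, a leaf at [u] gains [deg u - 1 >= 0] when [|S| > 3]. A first leaf
    has [deg u = 2], a strict gain except on the triangle, where the result is [D_4] with equality.
    On [D_n] only the end of the tail has degree 1, and a leaf there gives [D_(n+1)]. A strict
    inequality is never lost. *)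
Lemma unicyc_coef3_lower S : unicyc e S ->
  [\/ exists s, [/\ (2 < size s)%N, shaped e (cycle_rel (size s)) s & S = [set x in s]],
      exists s, [/\ (3 < size s)%N, shaped e D_rel s, S = [set x in s] &
        (I S)`_3 = (L #|S|)`_3] |
      (3 < #|S|)%N /\ (L #|S|)`_3 < (I S)`_3].
Proof.
elim=> [s s2 hs|S' u v uS' IH uS vS hv]; first by constructor 1; exists s.
have i3 := unicyc_leaf_coef3 R e_sym e_irr uS' uS vS hv.
have c3 := unicyc_card uS'.
have d1 := deg_gt0 (unicyc_connected e_sym uS') (unicyc_degree_sum e_sym e_irr uS') uS.
have c' : #|v |: S'| = #|S'|.+1 by rewrite cardsU1 vS.
have d2lt : (3 < #|S'|)%N -> (1 < deg e S' u)%N -> (L #|S'|)`_3 <= (I S')`_3 ->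
    (L #|v |: S'|)`_3 < (I (v |: S'))`_3.
  rewrite -(ltr_nat R) => c4 dd le; rewrite i3 c' lucas_coef3; last by rewrite -(ltr_nat R).
  by move: dd; rewrite -(ltr_nat R) => dd; lra.
case: IH => [[s [s2 hs sE]]|[s [s2 hs sE s3]]|[c4 lt]].
- have dC : deg e S' u = 2%N by rewrite sE; apply: deg_cycle => //; move: uS; rewrite sE inE.
  have cs : #|S'| = size s by rewrite sE card_set_seq //; case: hs.
  have IS : I S' = L #|S'| by rewrite cs sE (ipoly_cycle R e_sym e_irr s2 hs).
  have [s3|s3] := eqVneq (size s) 3%N; last first.
    constructor 3; rewrite c'; split; first by lia.
    by rewrite -c'; apply: d2lt; rewrite ?dC ?IS //; lia.
  constructor 2; have us : u \in s by move: uS; rewrite sE inE.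
  have pt := perm_rem us; have szt := perm_size pt.
  exists (rcons (rcons (rem u s) u) v).
  rewrite size_rcons -szt s3; split=> //.
  + have sz2 : size (rem u s) = 2%N by move: szt; rewrite size_rcons s3 => -[].
    apply: (@shaped_rcons _ _ 2).
    * apply: (shaped_triangle hs s3 pt) => i j.
      by move: i j => [|[|[|i]]] // [|[|[|j]]].
    * by rewrite size_rcons sz2.
    * by rewrite -(perm_mem pt); apply: contra vS; rewrite sE inE.
    * move=> y ys; rewrite nth_rcons sz2 /= hv //.
      by rewrite sE inE (perm_mem pt).
    * by rewrite size_rcons sz2; case=> [|[|[|]]].
  + apply/setP => x; rewrite !inE mem_rcons inE sE inE -(perm_mem pt); done.
  + rewrite i3 c' dC IS cs s3 (lucas_polySS _ 2) coef_addXM (lucas_polySS _ 1) coef_addXM.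
    rewrite (lucas_polySS _ 0) !coef_addXM /lucas_poly /= !coefC /= !coefMn !coefC /= !mul0rn.
    ring.
- have us : u \in s by move: uS; rewrite sE inE.
  have cs : #|S'| = size s by rewrite sE card_set_seq //; case: hs.
  have hi : (index u s < size s)%N by rewrite index_mem.
  have inS x0 i : (i < size s)%N -> nth x0 s i \in S' by move=> h; rewrite sE inE mem_nth.
  have eu i : (i < size s)%N -> e u (nth u s i) = D_rel (index u s) i.
    by move=> h; rewrite -{1}(nth_index u us); case: hs => _ ->.
  have uqs : uniq s by case: hs.
  have [iu|iu] := eqVneq (index u s) (size s).-1; last first.
    have dd : (1 < deg e S' u)%N.
      (* Position 0 has no predecessor; its neighbours are 1 and 2. *)
      have [i0|i0] := posnP (index u s).
        apply: (@deg_gt1 _ _ (nth u s 1%N) (nth u s 2%N)); rewrite ?eu ?inS ?i0 //; try lia.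
        by rewrite nth_uniq // ltnW // ltnW.
      have hp : ((index u s).-1 < size s)%N by lia.
      have hn : ((index u s).+1 < size s)%N by lia.
      apply: (@deg_gt1 _ _ (nth u s (index u s).-1) (nth u s (index u s).+1));
        rewrite ?eu ?inS ?nth_uniq //; rewrite /D_rel /sym_nat; lia.
    by constructor 3; rewrite {1}c'; split; [lia|apply: d2lt; rewrite ?s3 ?cs].
  constructor 2; exists (rcons s v); rewrite size_rcons; split.
  + by lia.
  + apply: (@shaped_rcons _ _ (size s).-1) => //.
    * by lia.
    * by apply: contra vS; rewrite sE inE.
    * move=> y ys; rewrite hv ?sE ?inE // -iu.
      by rewrite nth_index.
    * by move=> i hi'; rewrite /sym_nat; lia.
  + by apply/setP => x; rewrite !inE mem_rcons inE sE inE.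
  + have dd : deg e S' u = 1%N.
      rewrite /deg; have -> : [set y in S' | e u y] = [set nth u s (size s).-2].
        apply/setP => y; rewrite !inE; apply/andP/eqP => [[yS]|->]; last first.
          by rewrite inS ?eu //; try lia; rewrite iu /D_rel /sym_nat; lia.
        have ys : y \in s by move: yS; rewrite sE inE.
        have hy : (index y s < size s)%N by rewrite index_mem.
        rewrite -{1}(nth_index u ys) eu // iu => h; rewrite -{1}(nth_index u ys).
        by congr nth; move: h; rewrite /D_rel /sym_nat; lia.
      by rewrite cards1.
    rewrite i3 c' lucas_coef3 ?cs // dd s3 cs; ring.
- constructor 3; split; first by rewrite c'; lia.
  rewrite i3 c' lucas_coef3 //.
  by move: d1; rewrite -(ler_nat R) => d1; lra.
Qed.

(** Relative to the star, a leaf at [u] loses [|S| - 1 - deg u >= 0]. Equality needs [u] adjacent to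
    all other vertices: on a cycle this means a triangle, on [U_n] with [n > 3] the centre. *)
Lemma unicyc_coef3_upper S : unicyc e S ->
  [\/ exists s, [/\ (2 < size s)%N, shaped e (cycle_rel (size s)) s & S = [set x in s]],
      exists s, [/\ (3 < size s)%N, shaped e U_rel s, S = [set x in s] &
        (I S)`_3 = (star_poly R (#|S| - 3))`_3] |
      (3 < #|S|)%N /\ (I S)`_3 < (star_poly R (#|S| - 3))`_3].
Proof.
elim=> [s s2 hs|S' u v uS' IH uS vS hv]; first by constructor 1; exists s.
have i3 := unicyc_leaf_coef3 R e_sym e_irr uS' uS vS hv.
have c3 := unicyc_card uS'.
have c' : #|v |: S'| = #|S'|.+1 by rewrite cardsU1 vS.
have star : (star_poly R (#|v |: S'| - 3))`_3 =
    (star_poly R (#|S'| - 3))`_3 + (L #|S'|)`_2.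
  by rewrite c' subSn // star_coef3; congr (_ + (L _)`_2); lia.
have dle : (deg e S' u < #|S'|)%N by rewrite -(card_cnbhd e_irr uS) leq_addl.
have lt_deg : (3 < #|S'|)%N -> ((deg e S' u).+1 < #|S'|)%N ->
    (I S')`_3 <= (star_poly R (#|S'| - 3))`_3 ->
    (I (v |: S'))`_3 < (star_poly R (#|v |: S'| - 3))`_3.
  move=> _; rewrite -(ltr_nat R) -natr1 => dd le; rewrite i3 star.
  by lra.
case: IH => [[s [s2 hs sE]]|[s [s2 hs sE s3]]|[c4 lt]].
- have us : u \in s by move: uS; rewrite sE inE.
  have dC : deg e S' u = 2%N by rewrite sE; apply: deg_cycle.
  have cs : #|S'| = size s by rewrite sE card_set_seq //; case: hs.
  have IS : I S' = L #|S'| by rewrite cs sE (ipoly_cycle R e_sym e_irr s2 hs).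
  have [s3|s3] := eqVneq (size s) 3%N; last first.
    constructor 3; rewrite {1}c'; split; first by rewrite cs; lia.
    apply: lt_deg; rewrite ?dC ?cs; try lia.
    (* The cubic coefficients of cycle and star both vanish at lengths 3 and 4; for [n > 3] the step
       from [n] to [n + 1] widens the gap by [n - 2]. *)
    rewrite IS cs; elim: (size s) s2 {s3 cs hs sE IS} => [//|n IHn].
    rewrite leq_eqVlt => /orP[/eqP <-|n3].
      rewrite (proj2 (lucas3_coef R)) subnn.
      by rewrite /star_poly /edge_poly mulr1 !coefD coef1 coefZ !coefX mulr0 !addr0.
    have [n4|n4] := ltnP 3 n; last first.
      have -> : n = 3%N by lia.
      rewrite star_coef3 (lucas_polySS _ 2%N) coef_addXM (lucas_polySS _ 1%N) coef_addXM.
      rewrite (lucas_polySS _ 0%N) !coef_addXM.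
      rewrite !(proj1 (lucas_small_coef _ _)) !(proj2 (lucas_small_coef _ _)).
      by rewrite /star_poly /edge_poly mulr1 !coefD coef1 coefZ !coefX mulr0 !addr0.
    rewrite lucas_coef3 // subSn // star_coef3.
    have -> : ((n - 3).+3 = n)%N by lia.
    have := IHn n3; move: n4; rewrite -(ltr_nat R) => n4.
    by lra.
  constructor 2.
  have pt : perm_eq s (u :: rem u s) by apply: perm_to_rem.
  have szt := perm_size pt.
  exists (rcons (u :: rem u s) v).
  rewrite size_rcons -szt s3; split=> //.
  + apply: (@shaped_rcons _ _ 0%N) => //.
    * apply: (shaped_triangle hs s3 pt) => i j.
      by move: i j => [|[|[|i]]] // [|[|[|j]]].
    * by rewrite -(perm_mem pt); apply: contra vS; rewrite sE inE.
    * by move=> y ys; rewrite /= hv // sE inE (perm_mem pt).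
    * by rewrite -szt s3; case=> [|[|[|]]].
  + by apply/setP => x; rewrite 2!inE mem_rcons in_cons -(perm_mem pt) sE !inE.
  + rewrite i3 star dC IS cs s3 subnn (proj1 (lucas3_coef R)) (proj2 (lucas3_coef R)).
    rewrite /star_poly /edge_poly mulr1 !coefD coef1 coefZ !coefX mulr0 !addr0 /=.
    ring.
- have us : u \in s by move: uS; rewrite sE inE.
  have cs : #|S'| = size s by rewrite sE card_set_seq //; case: hs.
  have hi : (index u s < size s)%N by rewrite index_mem.
  have eu y : y \in s -> e u y = U_rel (index u s) (index y s).
    move=> ys; case: hs => _ hs; rewrite -(hs u) ?index_mem //.
    by rewrite !nth_index.
  have uqs : uniq s by case: hs.
  have [iu|iu] := eqVneq (index u s) 0%N; last first.
    constructor 3; rewrite {1}c'; split; first by lia.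
    apply: lt_deg; rewrite ?s3 ?cs //.
    suff : (deg e S' u <= 2)%N by lia.
    (* [a] is the centre and [b] a triangle vertex other than [u]. If [u] is a leaf, [b] is a
       harmless extra, since only the bound 2 is wanted. *)
    pose a := nth u s 0%N; pose b := nth u s (if index u s == 1%N then 2 else 1)%N.
    apply: (@leq_trans #|[set a; b]|); last by rewrite cards2; case: (_ == _).
    apply: subset_leq_card; apply/subsetP => y; rewrite !inE sE inE => /andP[ys].
    rewrite eu // => h; rewrite -(nth_index u ys) /a /b.
    have : (index y s == 0%N) || (index y s == if index u s == 1%N then 2 else 1)%N.
      by move: h iu; rewrite /U_rel /sym_nat; case: (index u s =P 1%N); lia.
    by case/orP=> /eqP->; rewrite eqxx ?orbT.
  constructor 2; exists (rcons s v); rewrite size_rcons; split.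
  + by lia.
  + apply: (@shaped_rcons _ _ 0%N) => //.
    * by lia.
    * by apply: contra vS; rewrite sE inE.
    * move=> y ys; rewrite hv ?sE ?inE // -iu.
      by rewrite nth_index.
    * by move=> i hi'; rewrite /sym_nat; lia.
  + by apply/setP => x; rewrite !inE mem_rcons inE sE inE.
  + have dd : (deg e S' u).+1 = #|S'|.
      have := card_cnbhd e_irr uS.
      suff -> : S' :\: cnbhd e u = set0 by rewrite cards0.
      apply/setP => y; rewrite !inE sE inE; case: (boolP (y \in s)) => ys; rewrite ?andbF //.
      rewrite eu // iu /U_rel /sym_nat /= andbT eq_sym.
      have [y0|y0] := eqVneq (index y s) 0%N; last by rewrite orbT.
      by rewrite -(nth_index u ys) y0 -iu nth_index // eqxx.
    by rewrite i3 star s3 -[in X in _ - X%:R]dd -natr1; ring.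
- constructor 3; split; first by rewrite c'; lia.
  rewrite i3 star; move: dle; rewrite -(ler_nat R) -natr1 => dle.
  by lra.
Qed.

End Extremal.

(** * From exactly one cycle to a construction by leaves *)

Section UniqueCycle.
Variable G : sgraph.
Local Notation e := (@adj G).
Implicit Types (S : {set G}) (c s p : seq G).

Lemma nth_next c x0 i : uniq c -> (i < size c)%N ->
  next c (nth x0 c i) = nth x0 c (i.+1 %% size c).
Proof.
move=> uc ic; rewrite next_nth mem_nth //.
case: c uc ic => // y p uc ic; rewrite index_uniq // modnS_lt //.
case: eqP => [iN|/eqP iN] /=.
  by rewrite nth_default //; move: iN; rewrite /= => -[->].
by apply: set_nth_default; rewrite /= in ic iN; lia.
Qed.

(** The closed path is a cycle, hence has the edges of [c]. Only its closing edge is extracted: in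
    the applications the starting point is chosen so that this is the offending edge. *)
Lemma cycle_edges_shared (c p : seq G) a : (exists! F : {set {set G}}, is_cycle F) ->
  (2 < size c)%N -> ucycle e c ->
  (1 < size p)%N -> path e a p -> e (last a p) a -> uniq (a :: p) ->
  exists2 x, x \in c & [set last a p; a] = [set x; next c x].
Proof.
case=> F [_ uF] c2 hc p1 pp ea up.
have hc' : is_cycle (cycle_edges c) by exists c.
have hp' : is_cycle (cycle_edges (a :: p)).
  by exists (a :: p); split=> //; rewrite /ucycle /= rcons_path pp ea.
have := uF _ hc'; rewrite (uF _ hp') => cE.
have : [set last a p; a] \in cycle_edges (a :: p).
  apply/imsetP; exists (last a p); first exact: mem_last.
  have := @nth_next (a :: p) a (size p) up (ltnSn _).
  by rewrite /= modnn nth_last /= => ->.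
by rewrite cE => /imsetP[x xc ->]; exists x.
Qed.

(** A chord [xy] and the arc of [c] from [x] to [y] form a cycle, so the chord is an edge of [c]
    after all. *)
Lemma unique_cycle_shaped c : (exists! F : {set {set G}}, is_cycle F) ->
  (2 < size c)%N -> ucycle e c -> shaped e (cycle_rel (size c)) c.
Proof.
move=> uF c2 hc; have [cc uc] : cycle e c /\ uniq c by apply/andP.
have csucc x0 i : (i < size c)%N -> e (nth x0 c i) (nth x0 c (i.+1 %% size c)).
  by move=> ic; rewrite -nth_next //; apply: next_cycle => //; apply: mem_nth.
split=> // x0 i j ic jc; apply/idP/idP => [eij|]; last first.
  by case/orP=> /eqP->; [|rewrite adj_sym]; apply: csucc.
set x := nth x0 c i in eij *; set y := nth x0 c j in eij *.
have xc : x \in c by apply: mem_nth.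
have yc : y \in c by apply: mem_nth.
have nx : next c x = nth x0 c (i.+1 %% size c) by apply: nth_next.
have ny : next c y = nth x0 c (j.+1 %% size c) by apply: nth_next.
have k0 : (0 < size c)%N by lia.
have [E|nE] := eqVneq (next c x) y.
  by move/eqP: E; rewrite nx nth_uniq ?ltn_mod // /cycle_rel eq_sym => ->.
have xy : x != y by apply: contraTneq eij => ->; rewrite adj_irrefl.
(* Rotate [c] to start at [x] and split it at [y]. The interior [p1] of the arc is nonempty because
   [y] is not the successor of [x], so the new cycle has at least 3 vertices. *)
have [r p rE] := rot_to xc.
have pE z : next c z = next (x :: p) z by rewrite -rE next_rot.
have up : uniq (x :: p) by rewrite -rE rot_uniq.
have pp : path e x (rcons p x) by have := cc; rewrite -(rot_cycle r) rE.
have yp : y \in p.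
  by have := yc; rewrite -(mem_rot r) rE inE eq_sym (negPf xy).
move: pE rE up pp; case/splitPr: yp => p1 p2 pE rE up pp.
have p1n : p1 != [::].
  by apply: contraNneq nE => p10; rewrite pE p10 /= eqxx.
have [||||z zc zE] := @cycle_edges_shared c (rcons p1 y) x uF c2 hc.
- by rewrite size_rcons ltnS lt0n size_eq0.
- move: pp; rewrite rcons_path cat_path /= => /andP[/and3P[p1p py _] _].
  by rewrite rcons_path p1p py.
- by rewrite last_rcons adj_sym.
- by move: up; rewrite -cat_rcons -cat_cons cat_uniq => /andP[].
move: zE; rewrite last_rcons => zE.
have : z \in [set y; x] by rewrite zE !inE eqxx.
have : next c z \in [set y; x] by rewrite zE !inE eqxx orbT.
have nz : next c z != z.
  apply/eqP => nz; have : #|[set y; x]| = #|[set z]| by rewrite zE nz setUid.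
  by rewrite cards2 cards1 eq_sym xy.
rewrite !inE => /orP[]/eqP n1 /orP[]/eqP n2.
- by move: nz; rewrite n1 n2 eqxx.
- by move: nE; rewrite -n2 n1 eqxx.
- by move/eqP: n1; rewrite n2 ny nth_uniq ?ltn_mod // /cycle_rel eq_sym orbC => ->.
- by move: nz; rewrite n1 n2 eqxx.
Qed.

Lemma connected_graph_on : connected_graph G -> connected_on e setT.
Proof.
move=> cG A _ /set0Pn[a aA] cA; apply/eqP; rewrite -subTset; apply/subsetP => b _.
have clA : closed e A.
  by move=> x y exy; apply/idP/idP => h; apply: cA h _ _; rewrite ?inE // adj_sym.
by rewrite -(closed_connect clA (cG a b)).
Qed.

(** [S] grows from the cycle. By connectedness some outside [v] has a neighbour [a] in [S]; a second
    neighbour [b] would, with a path from [a] to [b] inside [S], close a cycle whose edge [bv] must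
    lie on [c], although [v] is not in [S]. *)
Lemma unicyc_setT : connected_unicyclic G -> unicyc e setT.
Proof.
case=> cG uF; have cT := connected_graph_on cG.
have [F [[c [c2 hc _]] _]] := uF.
have /andP[cc uc] := hc.
suff grow n S : #|~: S| = n -> unicyc e S -> [set x in c] \subset S -> unicyc e setT.
  apply: (grow _ [set x in c] erefl) => //; apply: UnicycCycle => //.
  exact: unique_cycle_shaped.
elim: n S => [|n IH] S cS uS sS.
  by move/eqP: cS; rewrite cards_eq0 => /eqP E; rewrite -(setCK S) E setC0 in uS.
have [/existsP[v /existsP[a /and3P[aS vS eva]]]|nv] :=
  boolP [exists v, exists a, [&& a \in S, v \notin S & e v a]]; last first.
  have ST : S = setT.
    apply: cT; rewrite ?subsetT //.
      by rewrite -card_gt0 (leq_trans _ (unicyc_card uS)).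
    move=> a b aS _ eab; apply: contraNT nv => bS.
    by apply/existsP; exists b; apply/existsP; exists a; rewrite aS bS adj_sym.
  by rewrite -ST.
have [/existsP[b /and3P[bS ba evb]]|only] :=
    boolP [exists b, [&& b \in S, b != a & e v b]]; last first.
  apply: (IH (v |: S)).
  - by move: cS; rewrite (cardsD1 v) inE vS setCU setIC -setDE => -[].
  - apply: (UnicycLeaf uS aS vS) => y yS; apply/idP/eqP => [evy|->//].
    apply/eqP; apply: contraNT only => ya.
    by apply/existsP; exists y; rewrite yS ya.
  - by rewrite subsetU // sS orbT.
(* Adjacency within [S], so that the path from [a] to [b] avoids [v]. *)
pose r : rel G := fun x y => [&& x \in S, y \in S & e x y].
have : b \in [set y in S | connect r a y].
  have -> // : [set y in S | connect r a y] = S.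
  apply: (unicyc_connected (@adj_sym G) uS).
  - by apply/subsetP => y; rewrite inE => /andP[].
  - by apply/set0Pn; exists a; rewrite inE aS connect0.
  - move=> x y; rewrite !inE => /andP[xS ax] yS exy; rewrite yS.
    by apply: connect_trans ax _; apply: connect1; rewrite /r xS yS.
rewrite inE bS => /connectP[q qp bE].
move: bE; case/shortenP: qp => p pp up _ bE.
have pS : {subset a :: p <= S}.
  move=> x; rewrite inE => /orP[/eqP->//|].
  elim: p a aS pp {up bE ba eva} => [//|z p IHp] a' aS' /= /andP[/and3P[_ zS _] pz].
  by rewrite inE => /orP[/eqP->//|]; apply: IHp pz.
have [||||x xc xE] := @cycle_edges_shared c (a :: p) v uF c2 hc.
- by rewrite /= ltnS lt0n size_eq0; apply: contraNneq ba => p0; rewrite bE p0.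
- rewrite /= eva; apply: sub_path pp; by move=> x y /and3P[].
- by rewrite /= -bE adj_sym.
- by rewrite cons_uniq up andbT; apply: contra vS => /pS.
have : v \in [set x; next c x] by rewrite -xE !inE eqxx orbT.
by rewrite !inE => /orP[]/eqP vE; move: vS; rewrite vE (subsetP sS) // inE ?mem_next.
Qed.

End UniqueCycle.

(** * Back to graphs: [xi], the order, and the named families *)

Section Graphs.
Variable R : realType.

Lemma indep_polyE (G : sgraph) : indep_poly R G = ipoly R (@adj G) setT.
Proof.
apply/polyP => k; rewrite coef_poly /ipoly coef_sum.
have -> : \sum_(A : {set G} | (A \subset setT) && indep (@adj G) A) ('X^#|A| : {poly R})`_k =
    (indep_num G k)%:R.
  rewrite /indep_num -sum1_card natr_sum big_mkcond [RHS]big_mkcond /=.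
  apply: eq_bigr => A _; rewrite !inE subsetT /= coefXn eq_sym.
  rewrite -[independent A]/(indep (@adj G) A).
  by case: (indep _ _); case: (_ == k).
case: ltnP => // kG; rewrite /indep_num.
suff -> : [set A : {set G} | independent A & #|A| == k] = set0 by rewrite cards0.
apply/setP => A; rewrite !inE; apply/negP => /andP[_ /eqP Ak].
by have := max_card (mem A); rewrite Ak leqNgt kG.
Qed.

Lemma horner_indep0 (G : sgraph) : (indep_poly R G).[0] = 1.
Proof. by rewrite indep_polyE ipoly_at0. Qed.

(** A nonpositive value to the right of [xi] gives a real root between [xi] and 0, of smaller
    modulus than [xi]. *)
Lemma pos_on_xi (G : sgraph) : pos_on (xi R G) (indep_poly R G).
Proof.
move=> y /andP[+ y0]; rewrite /xi.
(* If [xget] returns its default 0, the interval is empty. *)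
case: classical_sets.xgetP => [x _ [_ xmin]|_]; last by rewrite ltNge y0.
move=> xy; rewrite ltNge; apply/negP => py.
have [|r /andP[yr r0] [pr _]] := largest_nonpos_root _ py y0.
  by rewrite horner_indep0.
have := xmin r%:C%C; rewrite (fmorph_root (real_complex R)) => /(_ pr).
rewrite !normc_def /= expr0n /= !addr0 !sqrtr_sqr lecR => h.
have xr := lt_le_trans xy yr.
by move: h; rewrite !ltr0_norm // ?lerN2 ?leNgt ?xr // (lt_trans xr).
Qed.

Lemma preceq_of_pos (G H : sgraph) :
  (forall y, xi R G < y <= 0 -> (indep_poly R G).[y] <= (indep_poly R H).[y]) ->
  preceq R H G.
Proof.
move=> h x /andP[xix]; rewrite le_eqVlt => /orP[/eqP->|x0]; first by rewrite !horner_indep0.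
move: xix; rewrite le_eqVlt => /orP[/eqP xE|xix]; last by apply: h; rewrite xix ltW.
by rewrite -xE in x0 *; apply: horner_le_closed.
Qed.

Section OrdinalGraphs.
Variables (n : nat) (r' : rel 'I_n) (r : rel nat).
Hypothesis rE : forall i j, sym_adj r' i j = r i j.

Lemma shaped_ord : shaped (@adj (graph_of_rel r')) r (enum 'I_n).
Proof.
split; first exact: enum_uniq.
by move=> x0 i j; rewrite size_enum_ord => hi hj; rewrite /= rE !nth_enum_ord.
Qed.

Lemma shaped_isomorphic (G : sgraph) (s : seq G) :
  shaped (@adj G) r s -> [set x in s] = setT -> #|G| = n ->
  isomorphic G (graph_of_rel r').
Proof.
move=> [us hs] sT cG.
have mem_s x : x \in s by have := in_setT x; rewrite -sT inE.
have sz : size s = n by rewrite -cG -cardsT -sT card_set_seq.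
have lt x : (index x s < n)%N by rewrite -sz index_mem.
exists (fun x => Ordinal (lt x) : graph_of_rel r'); split.
  apply: inj_card_bij; last by rewrite card_ord cG.
  by move=> x y [] h; rewrite -(nth_index x (mem_s x)) h nth_index.
move=> x y; rewrite [LHS]rE /= -(hs x) ?sz ?lt //.
by rewrite !nth_index.
Qed.

End OrdinalGraphs.

Lemma cycle_graph_adj n (i j : 'I_n) : (2 < n)%N ->
  sym_adj [rel i j : 'I_n | j == ordS i] i j = cycle_rel n i j.
Proof.
move=> n2; rewrite /sym_adj /= -!val_eqE /= /cycle_rel.
move: (ltn_ord i) (ltn_ord j); move: (nat_of_ord i) (nat_of_ord j) => a b an bn.
by rewrite !modnS_lt //; case: (a.+1 =P n); case: (b.+1 =P n); lia.
Qed.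

Lemma D_graph_adj n (i j : 'I_n) :
  sym_adj [rel i j : 'I_n | (j == i.+1 :> nat) || (i == 0%N :> nat) && (j == 2%N :> nat)] i j
  = D_rel i j.
Proof. by []. Qed.

Lemma U_graph_adj n (i j : 'I_n) :
  sym_adj [rel i j : 'I_n | (i == 0%N :> nat) || (i == 1%N :> nat) && (j == 2%N :> nat)] i j
  = U_rel i j.
Proof. by []. Qed.

Lemma cycle_graph_poly n : (2 < n)%N -> indep_poly R (cycle_graph n) = lucas_poly R n.
Proof.
move=> n2; rewrite indep_polyE.
have h := shaped_ord (fun i j => cycle_graph_adj i j n2).
have sz : size (enum 'I_n) = n by apply: size_enum_ord.
have sT : [set x in enum 'I_n] = setT by apply/setP => x; rewrite !inE mem_enum.
rewrite -[setT in LHS]sT -[in RHS]sz; apply: (ipoly_cycle R (@adj_sym _) (@adj_irrefl _)).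
  by rewrite sz.
by rewrite sz.
Qed.

(** The centre dominates the graph, and without it there remain the edge 12 and [n - 3] isolated
    vertices. *)
Lemma U_graph_poly n : (2 < n)%N -> indep_poly R (U_graph n) = star_poly R (n - 3).
Proof.
case: n => [|[|[|m]]] // _; rewrite indep_polyE !subSS subn0.
have e_sym := @adj_sym (U_graph m.+3); have e_irr := @adj_irrefl (U_graph m.+3).
have adjE (i j : 'I_m.+3) : @adj (U_graph m.+3) i j = U_rel i j by exact: U_graph_adj.
pose o k : U_graph m.+3 := (inord k : 'I_m.+3).
have oE k (i : 'I_m.+3) : (k < m.+3)%N -> (i == o k) = (i == k :> nat).
  by move=> h; rewrite -val_eqE /= inordK.
have ov k : (k < m.+3)%N -> nat_of_ord (o k) = k by move=> h; rewrite /o inordK.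
rewrite (ipolyD1 R e_sym e_irr (in_setT (o 0%N))).
have -> : setT :\: cnbhd (@adj (U_graph m.+3)) (o 0%N) = set0.
  apply/setP => x; rewrite !inE andbT; apply/negbF.
  by rewrite oE // adjE ov // /U_rel /sym_nat; lia.
rewrite ipoly0 mulr1 /star_poly; congr (_ + _).
have e12 : adj (o 1%N) (o 2%N) by rewrite adjE !ov.
have cK : (#|[set: U_graph m.+3] :\ o 0%N| - 2)%N = m.
  have := cardsD1 (o 0%N) setT; rewrite cardsT card_ord inE /= => h.
  by apply/eqP; rewrite -(eqn_add2l 3) -{2}[3%N]/(1 + 2)%N; move/eqP: h; lia.
rewrite (ipoly_edge_isolated R e_sym e_irr e12) ?cK //.
- by rewrite !inE andbT oE // ov.
- by rewrite !inE andbT oE // ov.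
move=> v z; rewrite !inE !andbT !oE // adjE /U_rel /sym_nat; lia.
Qed.

End Graphs.

Theorem theorem2p7 (R : realType) (n : nat) (G : sgraph) (hn : #|G| = n)
    (hG : connected_unicyclic G)
    (hC : ~ isomorphic G (cycle_graph n))
    (hD : ~ isomorphic G (D_graph n))
    (hU : ~ isomorphic G (U_graph n)) :
  prec R (cycle_graph n) G /\ prec R G (U_graph n).
Proof.
have e_sym := @adj_sym G; have e_irr := @adj_irrefl G.
have uT := unicyc_setT hG.
have n2 : (2 < n)%N by have := unicyc_card uT; rewrite cardsT hn.
have cT : #|[set: G]| = n by rewrite cardsT.
split; split.
- apply: preceq_of_pos => y hy; rewrite cycle_graph_poly // indep_polyE -hn.
  apply: (@ipoly_le_lucas _ _ _ (xi R G)) => //.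
  + exact: unicyc_connected.
  + exact: unicyc_degree_sum.
  + by rewrite hn (ltn_trans _ n2).
  + by rewrite -indep_polyE; apply: pos_on_xi.
(* Equal polynomials rule out the strict alternative for the coefficient of x^3, which leaves [C_n]
   and [D_n]. *)
- rewrite cycle_graph_poly // indep_polyE => E.
  have := unicyc_coef3_lower R e_sym e_irr uT; rewrite cT -E.
  case=> [[s [s2 hs sT]]|[s [s2 hs sT _]]|[_]]; last by rewrite ltxx.
  + apply: hC; have sz : size s = n by rewrite -hn -cardsT sT card_set_seq //; case: hs.
    rewrite sz in hs.
    exact: (shaped_isomorphic (fun i j => cycle_graph_adj i j n2) hs).
  + by apply: hD; apply: (shaped_isomorphic (@D_graph_adj n) hs).
(* The interval is now that of [U_n], the right-hand graph of the relation, so the positive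
   polynomial is [star_poly]. *)
- have hp := @pos_on_xi R (U_graph n); rewrite U_graph_poly // in hp.
  apply: preceq_of_pos => y hy; rewrite U_graph_poly // indep_polyE -cT.
  by apply: (star_poly_le_unicyc e_sym e_irr uT _ hy); rewrite cT.
- rewrite U_graph_poly // indep_polyE => E.
  have := unicyc_coef3_upper R e_sym e_irr uT; rewrite cT E.
  case=> [[s [s2 hs sT]]|[s [s2 hs sT _]]|[_]]; last by rewrite ltxx.
  + apply: hC; have sz : size s = n by rewrite -hn -cardsT sT card_set_seq //; case: hs.
    rewrite sz in hs.
    exact: (shaped_isomorphic (fun i j => cycle_graph_adj i j n2) hs).
  + by apply: hU; apply: (shaped_isomorphic (@U_graph_adj n) hs).
Qed.
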